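(* An exact Courant algebroid over $M$ (regarded as $TM\oplus T^*M$) acts on $T^*M$ by flat affine connections on $M$. That is: let $H\in\Omega^3(M)$ be closed and consider the exact Courant algebroid $(TM\oplus T^*M,\langle\,,\rangle_+,\mathrm{pr}_{TM},[\,,]_H)$. For every flat affine connection $\nabla$ on $M$ (not necessarily torsion-free), the pair $(\mathrm{pr},\varrho)$, where $\mathrm{pr}:T^*M\to M$ is the projection and $\varrho:\Gamma(TM\oplus T^*M)\to\mathfrak{X}(T^*M)$ is given by $\varrho(X+\alpha)=X^{h}$, is a Courant algebroid action of this Courant algebroid on the manifold $T^*M$.
   Context: Everything is smooth. A Courant algebroid over $M$ is a vector bundle $\mathbb{E}\to M$ with a non-degenerate symmetric pairing $\langle\,,\rangle$, an anchor $\rho:\mathbb{E}\to TM$ (bundle map over $\mathrm{id}_M$) and an $\mathbb{R}$-bilinear bracket on $\Gamma(\mathbb{E})$ with $[a,b]+[b,a]=\rho^*d\langle a,b\rangle$, $\rho(a)\langle b,c\rangle=\langle[a,b],c\rangle+\langle b,[a,c]\rangle$, $[a,[b,c]]=[[a,b],c]+[b,[a,c]]$, where $\langle\rho^*\alpha,b\rangle=\alpha(\rho(b))$. It is exact if $0\to T^*M\xrightarrow{\rho^*}\mathbb{E}\xrightarrow{\rho}TM\to0$ is exact. Every exact Courant algebroid is isomorphic to $TM\oplus T^*M$ with $\langle X+\alpha,Y+\beta\rangle_+=\alpha(Y)+\beta(X)$, anchor $\mathrm{pr}_{TM}$, and the bracket $[X+\alpha,Y+\beta]_H=[X,Y]_{\mathrm{Lie}}+L_X\beta-\iota_Yd\alpha+\iota_Y\iota_XH$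 for some closed $H\in\Omega^3(M)$; this is the meaning of ''regarded as $TM\oplus T^*M$''. For $X\in\mathfrak{X}(M)$, $X^h\in\mathfrak{X}(T^*M)$ is the horizontal lift of $X$ with respect to the dual connection of $\nabla$ on $T^*M$. A Courant algebroid action of a Courant algebroid over $M$ on a manifold $M'$ is a pair $(\Phi,\varrho)$ of a smooth map $\Phi:M'\to M$ and an $\mathbb{R}$-linear map $\varrho:\Gamma(\mathbb{E})\to\mathfrak{X}(M')$ such that for all $a,b\in\Gamma(\mathbb{E})$, $f\in C^\infty(M)$, $q\in M'$: $\Phi_{*q}(\varrho(a)_q)=\rho(a)_{\Phi(q)}$, $\varrho(fa)=(\Phi^*f)\varrho(a)$, and $[\varrho(a),\varrho(b)]_{\mathrm{Lie}}=\varrho([a,b])$. *)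

(* Defs.v *)
From HB Require Import structures.
From mathcomp Require Import all_boot all_order all_algebra.
From mathcomp Require Import all_classical all_reals all_analysis.
From mathcomp Require Import ring.
Import numFieldNormedType.Exports.
Import Order.TTheory GRing.Theory Num.Theory.

Set Implicit Arguments.
Unset Strict Implicit.
Unset Printing Implicit Defensive.

Local Open Scope classical_set_scope.
Local Open Scope ring_scope.

Section Smooth.
Context {R : realType}.

(* Meant for an open set [W]. *)
Fixpoint Ck {n : nat} (k : nat) (W : set 'rV[R]_n) (g : 'rV[R]_n -> R) : Prop :=
  match k with
  | 0 => forall x, W x -> {for x, continuous g}
  | k'.+1 => (forall x, W x -> differentiable g x) /\
             (forall i : 'I_n, Ck k' W ('D_(delta_mx 0 i) g))
  end.

Definition smooth_on {n : nat} (W : set 'rV[R]_n) (g : 'rV[R]_n -> R) : Prop :=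
  forall k, Ck k W g.

Definition smooth_on_rV {m n : nat} (W : set 'rV[R]_m)
    (h : 'rV[R]_m -> 'rV[R]_n) : Prop :=
  forall j : 'I_n, smooth_on W (fun x => h x 0 j).

Section Closure.
Variables (n : nat) (W : set 'rV[R]_n).
Hypothesis oW : open W.
Implicit Types (f g : 'rV[R]_n -> R) (k : nat).

Lemma near_differentiable (f g : 'rV[R]_n -> R) x :
  (\forall y \near x, f y = g y) -> differentiable f x -> differentiable g x.
Proof.
move=> efg /diff_locallyP[cd fE].
have gE : g \o shift x = cst (g x) + 'd f x +o_ 0 id.
  move/eqaddoP: fE => fE; apply/eqaddoP => e e0.
  have {}fE := fE _ e0.
  have efg0 : \forall y \near (0 : 'rV[R]_n), f (y + x) = g (y + x).
    rewrite (near_shift x); apply: filterS efg => z ez.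
    by rewrite /= sub0r addrNK.
  apply: filterS2 efg0 fE => y E1.
  by rewrite !fctE /= E1 (nbhs_singleton efg).
have dE : 'd g x = 'd f x :> (_ -> _) by apply: diff_unique.
by apply/diff_locallyP; rewrite dE.
Unshelve. all: by end_near. Qed.

Lemma Ck_ext k f g : (forall x, W x -> f x = g x) -> Ck k W f -> Ck k W g.
Proof.
elim: k f g => [|k IH] f g efg /=.
all: have efgn x : W x -> \forall y \near x, f y = g y
  by move=> Wx; apply: filterS efg _; exact: open_nbhs_nbhs.
  move=> cf x Wx; rewrite /prop_for /continuous_at -efg //.
  move: (cf x Wx); apply: cvg_trans; apply: (@near_eq_cvg _ _ (nbhs x)); exact: efgn.
move=> [df Df]; split=> [x Wx|i].
  exact: near_differentiable (efgn x Wx) (df x Wx).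
apply: IH (Df i) => x Wx; apply: near_eq_derive; exact: efgn.
Qed.

Lemma CkW k f : Ck k.+1 W f -> Ck k W f.
Proof.
elim: k f => [|k IH] f [df Df].
  by move=> x Wx; exact/differentiable_continuous/df.
by split=> // i; apply: IH (Df i).
Qed.

Lemma Ck_cst k (c : R) : Ck k W (cst c).
Proof.
elim: k c => [|k IH] c /=; first by move=> x _; exact: cst_continuous.
split=> [x _|i]; first exact: differentiable_cst.
by apply: Ck_ext (IH 0) => x _; rewrite derive_cst.
Qed.

Lemma CkD k f g : Ck k W f -> Ck k W g -> Ck k W (f + g).
Proof.
elim: k f g => [|k IH] f g.
  by move=> cf cg x Wx; apply: continuousD; [exact: cf|exact: cg].
move=> [df Df] [dg Dg]; split=> [x Wx|i].
  by apply: differentiableD; [exact: df|exact: dg].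
apply: Ck_ext (IH _ _ (Df i) (Dg i)) => x Wx.
by rewrite deriveD //; apply: diff_derivable; [exact: df|exact: dg].
Qed.

Lemma CkM k f g : Ck k W f -> Ck k W g -> Ck k W (f * g).
Proof.
elim: k f g => [|k IH] f g.
  by move=> cf cg x Wx; apply: continuousM; [exact: cf|exact: cg].
move=> Cf Cg; have [[df Df] [dg Dg]] := (Cf, Cg); split=> [x Wx|i].
  by apply: differentiableM; [exact: df|exact: dg].
apply: Ck_ext (CkD (IH _ _ (CkW Cf) (Dg i)) (IH _ _ (CkW Cg) (Df i))) => x Wx.
by rewrite deriveM //; apply: diff_derivable; [exact: df|exact: dg].
Qed.

Lemma Ck_sum k p (f : 'I_p -> 'rV[R]_n -> R) :
  (forall j, Ck k W (f j)) -> Ck k W (\sum_(j < p) f j).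
Proof.
move=> Cf; apply: (big_ind (Ck k W)) => //; first exact: (Ck_cst k 0).
by move=> f1 f2; exact: CkD.
Qed.

End Closure.

Lemma sub_Ck n k (V W : set 'rV[R]_n) g : V `<=` W -> Ck k W g -> Ck k V g.
Proof.
move=> VW; elim: k g => [|k IH] g /=; first by move=> cg x /VW /cg.
by move=> [dg Dg]; split=> [x /VW /dg//|i]; apply: IH (Dg i).
Qed.

Lemma Ck_local n k (W : set 'rV[R]_n) g :
  (forall x, W x -> exists V, V x /\ Ck k V g) -> Ck k W g.
Proof.
elim: k g => [|k IH] g H /=.
  by move=> x /H [V [Vx cg]]; exact: cg.
split=> [x /H[V [Vx [dg _]]]|i]; first exact: dg.
by apply: IH => x /H[V [Vx [_ Dg]]]; exists V; split=> //; exact: Dg.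
Qed.

Lemma smooth_cst n (W : set 'rV[R]_n) c : open W -> smooth_on W (cst c).
Proof. by move=> oW k; exact: Ck_cst. Qed.

Lemma smooth_comp m n (W : set 'rV[R]_m) (V : set 'rV[R]_n) h g :
  open W -> smooth_on_rV W h -> (forall x, W x -> V (h x)) ->
  smooth_on V g -> smooth_on W (g \o h).
Proof.
move=> oW sh hWV sg k; have hE : h = (fun x => \sum_(j < n) h x 0 j *: delta_mx 0 j).
  by apply/funext => x; rewrite -row_sum_delta.
have dh x : W x -> differentiable h x.
  move=> Wx; rewrite hE -fct_sumE; apply: differentiable_sum => j.
  by apply: differentiableZl; have [+ _] := sh j 1; apply.
elim: k g sg => [|k IH] g sg.
  move=> x Wx; apply: continuous_comp; first exact/differentiable_continuous/dh.
  by apply: (sg 0); exact: hWV.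
have [dg _] := sg 1; split=> [x Wx|i].
  by apply: differentiable_comp; [exact: dh|exact/dg/hWV].
pose S := \sum_(j < n) ('D_(delta_mx 0 j) g \o h)
            * ('D_(delta_mx 0 i) (fun x => h x 0 j)).
apply: (@Ck_ext _ _ oW k S) => [x Wx|]; last first.
  apply: Ck_sum => // j; apply: CkM => //; last by have [_ +] := sh j k.+1; apply.
  by apply: IH => k'; have [_ +] := sg k'.+1; apply.
have dhx := dh x Wx; have dgx := dg _ (hWV x Wx).
rewrite deriveE; last exact: differentiable_comp.
rewrite diff_comp //= -(deriveE _ dhx) /S fct_sumE.
have -> : 'D_(delta_mx 0 i) h x =
    \sum_(j < n) 'D_(delta_mx 0 i) (fun y => h y 0 j) x *: delta_mx 0 j.
  by rewrite derive_mx; [rewrite [LHS]row_sum_delta; apply: eq_bigr => j _; rewrite mxE|exact: diff_derivable].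
rewrite linear_sum; apply: eq_bigr => j _ /=.
by rewrite linearZ /= -(deriveE _ dgx) mulrC.
Qed.
End Smooth.

(* A set with a family of parametrizations of its subsets by open subsets of
   R^n; only the values of [param c] on [dom c] matter. *)
Record atlas (R : realType) (n : nat) := Atlas {
  pt :> Type;
  chart : Type;
  dom : chart -> set 'rV[R]_n;
  dom_open : forall c, open (dom c);
  param : chart -> 'rV[R]_n -> pt
}.

Section Manifold.
Context {R : realType} {n : nat} (M : atlas R n).

(* The topology of [M] is the one for which every [param c] is a homeomorphism
   of [dom c] onto an open subset of [M]. *)
Definition atlas_open (A : set M) : Prop :=
  forall c : chart M, open (dom c `&` param c @^-1` A).

Definition overlap (c d : chart M) : set 'rV[R]_n :=
  [set u | dom c u /\ (param d @` dom d) (param c u)].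

Record is_manifold : Prop := {
  chart_inj : forall c : chart M, {in dom c &, injective (param c)};
  chart_cover : forall p : M, exists c : chart M, (param c @` dom c) p;
  overlap_open : forall c d : chart M, open (overlap c d);
  transition_smooth : forall c d : chart M,
    exists h : 'rV[R]_n -> 'rV[R]_n, smooth_on_rV (overlap c d) h /\
      forall u, overlap c d u -> dom d (h u) /\ param d (h u) = param c u;
  manifold_hausdorff : forall p q : M, p <> q ->
    exists A B : set M,
      [/\ atlas_open A, atlas_open B, A p, B q & A `&` B = set0];
  manifold_second_countable : exists B : nat -> set M,
    (forall k, atlas_open (B k)) /\
    (forall A p, atlas_open A -> A p -> exists k, B k p /\ B k `<=` A)
}.
End Manifold.

Record manifold (R : realType) (n : nat) := Manifold {
  manifold_atlas :> atlas R n;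
  manifoldP : is_manifold manifold_atlas
}.

Section SmoothFunctions.
Context {R : realType} {n : nat} {M : atlas R n}.

Definition smooth_fun : {pred M -> R} :=
  fun f => `[< forall c : chart M, smooth_on (dom c) (f \o param c) >].

Fact smooth_fun_subring : subring_closed smooth_fun.
Proof.
have sub1 : (1 : M -> R) \in smooth_fun.
  by apply/asboolP => c; exact: smooth_cst (@dom_open _ _ M c).
split=> // f g /asboolP sf /asboolP sg; apply/asboolP => c k.
- have oc := @dom_open _ _ M c.
  have := CkD oc (sf c k) (CkM oc (Ck_cst oc k (-1)) (sg c k)).
  by apply: Ck_ext => // u _; rewrite !fctE /= mulN1r.
- have := CkM (@dom_open _ _ M c) (sf c k) (sg c k).
  by apply: Ck_ext => //; exact: dom_open.
Qed.
HB.instance Definition _ :=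
  GRing.isSubringClosed.Build (M -> R) smooth_fun smooth_fun_subring.

End SmoothFunctions.

Record smoothf (R : realType) (n : nat) (M : atlas R n) := SmoothF {
  smoothf_val :> M -> R;
  _ : smoothf_val \in smooth_fun
}.
Notation "''C^oo' ( M )" := (smoothf M) (at level 8, format "''C^oo' ( M )").

Section SmoothFunctionsRing.
Context {R : realType} {n : nat} {M : atlas R n}.
HB.instance Definition _ := [isSub for @smoothf_val R n M].
HB.instance Definition _ := [Choice of 'C^oo(M) by <:].
HB.instance Definition _ := 
  GRing.SubChoice_isSubComPzRing.Build _ _ 'C^oo(M) (subringClosedP _).

Fact constf_subproof (c : R) : (cst c : M -> R) \in smooth_fun.
Proof. by apply/asboolP => d; exact: smooth_cst (@dom_open _ _ M d). Qed.
Definition constf (c : R) : 'C^oo(M) := SmoothF (constf_subproof c).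

Lemma smoothfE (f g : 'C^oo(M)) : (forall p, f p = g p) -> f = g.
Proof. by move=> fg; apply/val_inj/funext. Qed.
Lemma smoothfD (f g : 'C^oo(M)) p : (f + g) p = f p + g p. Proof. by []. Qed.
Lemma smoothfN (f : 'C^oo(M)) p : (- f) p = - f p. Proof. by []. Qed.
Lemma smoothfM (f g : 'C^oo(M)) p : (f * g) p = f p * g p. Proof. by []. Qed.
Lemma smoothf0 p : (0 : 'C^oo(M)) p = 0. Proof. by []. Qed.
End SmoothFunctionsRing.

(* Tangent vectors at [p] are derivations at [p] of the algebra of smooth
   functions; since [constf] embeds R, the first condition is R-linearity. *)
Section Tangent.
Context {R : realType} {n : nat} {M : atlas R n}.
Implicit Type p : M.

Definition derivation_at p : {pred 'C^oo(M) -> R^o} := fun v =>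
  `[< (forall (c : R) f g, v (constf c * f + g) = c * v f + v g) /\
      (forall f g, v (f * g) = f p * v g + g p * v f) >].

Fact derivation_at_submod p : submod_closed (derivation_at p).
Proof.
split=> [|a v w /asboolP[vD vM] /asboolP[wD wM]]; apply/asboolP; split.
- by move=> c f g; rewrite [in RHS]/0%R /= mulr0 addr0.
- by move=> f g; rewrite [in RHS]/0%R /= !mulr0 addr0.
- by move=> c f g; rewrite !fctE /= vD wD /GRing.scale /=; ring.
- by move=> f g; rewrite !fctE /= vM wM /GRing.scale /=; ring.
Qed.
HB.instance Definition _ p := GRing.isSubmodClosed.Build R ('C^oo(M) -> R^o)
  (derivation_at p) (derivation_at_submod p).

Record tangent p := Tangent {
  tangent_val :> 'C^oo(M) -> R^o;
  _ : tangent_val \in derivation_at p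
}.
HB.instance Definition _ p := [isSub for @tangent_val p].
HB.instance Definition _ p := [Choice of tangent p by <:].
HB.instance Definition _ p := [SubChoice_isSubLmodule of tangent p by <:].

Definition linear_functional p : {pred tangent p -> R^o} := fun xi =>
  `[< forall (c : R) v w, xi (c *: v + w) = c * xi v + xi w >].

Fact linear_functional_submod p : submod_closed (@linear_functional p).
Proof.
split=> [|a x y /asboolP xD /asboolP yD]; apply/asboolP => c v w.
  by rewrite [in RHS]/0%R /= mulr0 addr0.
by rewrite !fctE /= xD yD /GRing.scale /=; ring.
Qed.
HB.instance Definition _ p := GRing.isSubmodClosed.Build R (tangent p -> R^o)
  (@linear_functional p) (@linear_functional_submod p).

Record covector p := Covector {
  covector_val :> tangent p -> R^o;
  _ : covector_val \in @linear_functional p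
}.
HB.instance Definition _ p := [isSub for @covector_val p].
HB.instance Definition _ p := [Choice of covector p by <:].
HB.instance Definition _ p := [SubChoice_isSubLmodule of covector p by <:].
End Tangent.
Arguments tangent {R n} M p.
Arguments covector {R n} M p.

(* Smooth vector fields on [M] are derivations of the algebra of smooth
   functions: a family of tangent vectors X_p such that p |-> X_p f is smooth
   for all smooth f amounts to such a derivation; [vfield_at X p] is X_p. *)
Section VectorFields.
Context {R : realType} {n : nat} {M : atlas R n}.

Definition derivation : {pred 'C^oo(M) -> 'C^oo(M)^o} := fun X =>
  `[< (forall (c : R) f g, X (constf c * f + g) = constf c * X f + X g) /\
      (forall f g, X (f * g) = f * X g + g * X f) >].

Fact derivation_submod : submod_closed derivation.
Proof.
split=> [|a v w /asboolP[vD vM] /asboolP[wD wM]]; apply/asboolP; split.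
- by move=> c f g; rewrite [in RHS]/0%R /= mulr0 addr0.
- by move=> f g; rewrite [in RHS]/0%R /= !mulr0 addr0.
- by move=> c f g; rewrite !fctE /= vD wD /GRing.scale /=; ring.
- by move=> f g; rewrite !fctE /= vM wM /GRing.scale /=; ring.
Qed.
HB.instance Definition _ := GRing.isSubmodClosed.Build 'C^oo(M)
  ('C^oo(M) -> 'C^oo(M)^o) derivation derivation_submod.
End VectorFields.

Record vfield (R : realType) (n : nat) (M : atlas R n) := VField {
  vfield_val :> 'C^oo(M) -> 'C^oo(M)^o;
  _ : vfield_val \in derivation
}.

Section VectorFieldsModule.
Context {R : realType} {n : nat} {M : atlas R n}.
HB.instance Definition _ := [isSub for @vfield_val R n M].
HB.instance Definition _ := [Choice of vfield M by <:].
HB.instance Definition _ := [SubChoice_isSubLmodule of vfield M by <:].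
End VectorFieldsModule.

Section LieBracket.
Context {R : realType} {n : nat} {M : atlas R n}.
Implicit Types (X Y Z : vfield M) (f g : 'C^oo(M)).

Lemma vfieldP X : vfield_val X \in derivation. Proof. by case: X. Qed.
Lemma vfieldD X f g : X (f + g) = X f + X g.
Proof.
have /asboolP[XD _] := vfieldP X; have := XD 1 f g.
have -> : constf 1 = 1 :> 'C^oo(M) by exact: smoothfE.
by rewrite !mul1r.
Qed.
Lemma vfieldZ X (c : R) f : X (constf c * f) = constf c * X f.
Proof.
have /asboolP[XD _] := vfieldP X.
have X0 : X 0 = 0 by have := vfieldD X 0 0; rewrite addr0 => /(canLR (addrK _)); rewrite subrr.
by have := XD c f 0; rewrite X0 !addr0.
Qed.
Lemma vfieldM X f g : X (f * g) = f * X g + g * X f.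
Proof. by have /asboolP[_] := vfieldP X; apply. Qed.
Lemma vfieldN X f : X (- f) = - X f.
Proof.
have -> : - f = constf (-1) * f by apply: smoothfE => p; rewrite smoothfM mulN1r.
by rewrite vfieldZ; apply: smoothfE => p; rewrite smoothfM mulN1r.
Qed.
Lemma vfieldB X f g : X (f - g) = X f - X g.
Proof. by rewrite vfieldD vfieldN. Qed.

Fact vfield_at_subproof X p :
  (fun f => X f p : R^o) \in @derivation_at _ _ M p.
Proof.
apply/asboolP; split=> [c f g|f g]; first by rewrite vfieldD vfieldZ.
by rewrite vfieldM.
Qed.
Definition vfield_at X (p : M) : tangent M p := Tangent (vfield_at_subproof X p).

Fact lie_subproof X Y :
  (fun f => X (Y f) - Y (X f) : 'C^oo(M)^o) \in @derivation _ _ M.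
Proof.
apply/asboolP; split=> [c f g|f g].
  by rewrite !vfieldD !vfieldZ; ring.
by rewrite !vfieldM !vfieldD !vfieldM; ring.
Qed.
Definition lie X Y : vfield M := VField (lie_subproof X Y).
End LieBracket.

(* A differential k-form is an alternating 'C^oo(M)-multilinear map from
   k-tuples of vector fields to 'C^oo(M).  The sign and normalization
   conventions of [d] are those of the invariant formula without factor. *)
Section Forms.
Context {R : realType} {n : nat} {M : atlas R n}.

Definition tensorial : {pred vfield M -> 'C^oo(M)^o} := fun a =>
  `[< forall (f : 'C^oo(M)) X Y, a (f *: X + Y) = f * a X + a Y >].

Fact tensorial_submod : submod_closed tensorial.
Proof.
split=> [|h a b /asboolP aD /asboolP bD]; apply/asboolP => f X Y.
  by rewrite [in RHS]/0%R /= mulr0 addr0.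
by rewrite !fctE /= aD bD /GRing.scale /=; ring.
Qed.
HB.instance Definition _ := GRing.isSubmodClosed.Build 'C^oo(M)
  (vfield M -> 'C^oo(M)^o) tensorial tensorial_submod.
End Forms.

Record form1 (R : realType) (n : nat) (M : atlas R n) := Form1 {
  form1_val :> vfield M -> 'C^oo(M)^o;
  _ : form1_val \in tensorial
}.

Record form2 (R : realType) (n : nat) (M : atlas R n) := Form2 {
  form2_val :> vfield M -> vfield M -> 'C^oo(M);
  form2_tensl : forall Y, form2_val^~ Y \in tensorial;
  form2_tensr : forall X, form2_val X \in tensorial;
  form2_alt : forall X, form2_val X X = 0
}.

Record form3 (R : realType) (n : nat) (M : atlas R n) := Form3 {
  form3_val :> vfield M -> vfield M -> vfield M -> 'C^oo(M);
  form3_tens1 : forall Y Z, (fun X => form3_val X Y Z) \in tensorial;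
  form3_tens2 : forall X Z, (fun Y => form3_val X Y Z) \in tensorial;
  form3_tens3 : forall X Y, (fun Z => form3_val X Y Z) \in tensorial;
  form3_alt12 : forall X Z, form3_val X X Z = 0;
  form3_alt23 : forall X Z, form3_val X Z Z = 0
}.

Section FormOperations.
Context {R : realType} {n : nat} {M : atlas R n}.
Implicit Types (X Y Z W : vfield M) (a b : form1 M) (f : 'C^oo(M)).

HB.instance Definition _ := [isSub for @form1_val R n M].
HB.instance Definition _ := [Choice of form1 M by <:].
HB.instance Definition _ := [SubChoice_isSubLmodule of form1 M by <:].

Lemma form1_tens a f X Y : a (f *: X + Y) = f * a X + a Y.
Proof. by case: a => a /= /asboolP; apply. Qed.
Lemma vfield_scaleE f X Y g : (f *: X + Y) g = f * X g + Y g.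
Proof. by []. Qed.
Lemma form1D a X Y : a (X + Y) = a X + a Y.
Proof. by rewrite -[X]scale1r form1_tens mul1r scale1r. Qed.
Lemma form1Z a f X : a (f *: X) = f * a X.
Proof.
have a0 : a 0 = 0.
  by have := form1D a 0 0; rewrite addr0 => /(canLR (addrK _)); rewrite subrr.
by rewrite -[f *: X]addr0 form1_tens a0 addr0.
Qed.

Lemma lieDZr X f Y Z : lie X (f *: Y + Z) = f *: lie X Y + (X f *: Y + lie X Z).
Proof.
apply/val_inj/funext => g; rewrite /= !fctE /=.
rewrite vfieldD (vfieldM X f (Y g)).
by rewrite /GRing.scale /=; ring.
Qed.
Lemma lieDZl f X Y Z : lie (f *: X + Y) Z = f *: lie X Z + (- Z f *: X + lie Y Z).
Proof.
apply/val_inj/funext => g; rewrite /= !fctE /=.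
rewrite vfieldD (vfieldM Z f (X g)).
by rewrite /GRing.scale /=; ring.
Qed.

Fact lie_derivative_subproof X b :
  (fun Z => X (b Z) - b (lie X Z) : 'C^oo(M)^o) \in @tensorial _ _ M.
Proof.
apply/asboolP => f Y Z.
by rewrite lieDZr !form1_tens vfieldD vfieldM; ring.
Qed.
Definition lie_derivative X b : form1 M := Form1 (lie_derivative_subproof X b).

Definition d1_val a X Y : 'C^oo(M) := X (a Y) - Y (a X) - a (lie X Y).
Fact d1_tensl a Y : d1_val a ^~ Y \in @tensorial _ _ M.
Proof.
apply/asboolP => f X Z; rewrite /d1_val lieDZl !form1_tens.
by rewrite vfieldD vfieldM vfield_scaleE; ring.
Qed.
Fact d1_tensr a X : d1_val a X \in @tensorial _ _ M.
Proof.
apply/asboolP => f Y Z; rewrite /d1_val lieDZr !form1_tens.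
by rewrite vfieldD vfieldM vfield_scaleE; ring.
Qed.
Fact d1_alt a X : d1_val a X X = 0.
Proof.
rewrite /d1_val subrr sub0r; have -> : lie X X = 0 *: X.
  by rewrite scale0r; apply/val_inj/funext => g /=; rewrite subrr.
by rewrite form1Z mul0r oppr0.
Qed.
(* the exterior derivative da *)
Definition d1 a : form2 M := Form2 (d1_tensl a) (d1_tensr a) (d1_alt a).

(* i_X w, the contraction in the first argument *)
Definition contract2 X (w : form2 M) : form1 M := Form1 (form2_tensr w X).
Definition contract3 X (H : form3 M) : form2 M :=
  Form2 (form3_tens2 H X) (form3_tens3 H X) (form3_alt23 H X).

(* dH = 0, by the invariant formula *)
Definition closed_form3 (H : form3 M) : Prop := forall X Y Z W,
  X (H Y Z W) - Y (H X Z W) + Z (H X Y W) - W (H X Y Z)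
  - H (lie X Y) Z W + H (lie X Z) Y W - H (lie X W) Y Z
  - H (lie Y Z) X W + H (lie Y W) X Z - H (lie Z W) X Y = 0.
End FormOperations.

(* [h] is a local representative of the map: near every point the map sends
   the image of some parametrization into that of another one, smoothly. *)
Record smooth_map (R : realType) (m n : nat) (M : atlas R m) (N : atlas R n) :=
  SmoothMap {
  smooth_map_val :> M -> N;
  smooth_mapP : forall (c : chart M) u, dom c u ->
    exists (d : chart N) (h : 'rV[R]_m -> 'rV[R]_n) (W : set 'rV[R]_m),
      [/\ open W, W u, W `<=` dom c, smooth_on_rV W h &
          forall w, W w ->
            dom d (h w) /\ param d (h w) = smooth_map_val (param c w)]
}.

Section SmoothMaps.
Context {R : realType} {m n : nat} {M : atlas R m} {N : atlas R n}.
Variable Phi : smooth_map M N.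

Fact pullback_subproof (f : 'C^oo(N)) : (f \o Phi) \in @smooth_fun _ _ M.
Proof.
apply/asboolP => c k; apply: Ck_local => u /(smooth_mapP Phi).
move=> [d [h [W [oW Wu _ sh hE]]]]; exists W; split=> //.
have /asboolP/(_ d) sf := valP f.
have hd w : W w -> dom d (h w) by case/hE.
apply: (Ck_ext oW _ (smooth_comp oW sh hd sf k)) => w Ww /=.
by have [_ ->] := hE _ Ww.
Qed.
Definition pullback (f : 'C^oo(N)) : 'C^oo(M) := SmoothF (pullback_subproof f).

Fact pushforward_subproof p (v : tangent M p) :
  (fun f => v (pullback f) : R^o) \in @derivation_at _ _ N (Phi p).
Proof.
case: v => v /= /asboolP[vD vM]; apply/asboolP; split=> [c f g|f g].
  by rewrite -vD; congr (v _); exact: smoothfE.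
by rewrite -[f (Phi p)]/(pullback f p) -[g (Phi p)]/(pullback g p) -vM;
  congr (v _); exact: smoothfE.
Qed.
Definition pushforward p (v : tangent M p) : tangent N (Phi p) :=
  Tangent (pushforward_subproof v).
End SmoothMaps.

Section Cotangent.
Context {R : realType} {n : nat} (M : atlas R n).

Fact coord_vector_subproof (c : chart M) u (cu : dom c u) (i : 'I_n) :
  (fun f : 'C^oo(M) => 'D_(delta_mx 0 i) (f \o param c) u : R^o)
    \in derivation_at (param c u).
Proof.
have dv (f : 'C^oo(M)) : derivable (f \o param c : 'rV[R]_n -> R) u (delta_mx 0 i).
  have /asboolP/(_ c 1)[df _] := valP f.
  by apply: diff_derivable; exact: df.
apply/asboolP; split=> [a f g|f g].
  by rewrite -[RHS]/(a *: _ + _) -deriveZ // -deriveD //; exact: derivableZ.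
by rewrite -[RHS]/((f \o param c) u *: _ + (g \o param c) u *: _) -deriveM.
Qed.
Definition coord_vector (c : chart M) u (cu : dom c u) (i : 'I_n) :
  tangent M (param c u) := Tangent (coord_vector_subproof cu i).

(* The covector sum_i y_i dx^i at [param c u], i.e. the one whose value at the
   i-th coordinate vector is y_i. *)
Definition coord_covector (c : chart M) u (y : 'rV[R]_n) :
  covector M (param c u) :=
  xget 0 [set xi : covector M (param c u) |
            forall (cu : dom c u) i, xi (coord_vector cu i) = y 0 i].

Fact cotangent_dom_open (c : chart M) :
  open [set z : 'rV[R]_(n + n) | dom c (lsubmx z)].
Proof.
have cl : continuous (lsubmx : 'rV[R]_(n + n) -> 'rV[R]_n).
  exact: continuous_lsubmx.
by move/continuousP: cl; apply; exact: dom_open.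
Qed.

(* Points of the cotangent bundle are pairs of a point and a covector at it;
   each parametrization of [M] induces one of the cotangent bundle. *)
Definition cotangent : atlas R (n + n) :=
  @Atlas R (n + n) {p : M & covector M p} (chart M)
    (fun c => [set z | dom c (lsubmx z)]) cotangent_dom_open
    (fun c z => existT _ (param c (lsubmx z))
                         (coord_covector c (lsubmx z) (rsubmx z))).

Fact cotangent_proj_subproof (c : chart cotangent) u : dom c u ->
  exists (d : chart M) (h : 'rV[R]_(n + n) -> 'rV[R]_n) W,
    [/\ open W, W u, W `<=` dom c, smooth_on_rV W h &
        forall w, W w -> dom d (h w) /\
          param d (h w) = projT1 (param c w : {p : M & covector M p})].
Proof.
move=> cu; exists c, lsubmx, (dom c).
have oc : open (dom c) := @dom_open _ _ cotangent c.
split=> // j k.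
apply: (@Ck_ext _ _ _ oc k (fun x => x 0 (lshift n j))).
  by move=> x _; rewrite mxE.
case: k => [|k].
  by move=> x _; exact: coord_continuous.
split=> [x _|i]; first exact: differentiable_coord.
apply: (Ck_ext oc (f := cst ((delta_mx 0 i : 'rV[R]_(n + n)) 0 (lshift n j))));
  last exact: Ck_cst.
move=> x _ /=.
have := derive_mx (@derivable_id R 'rV[R]_(n + n) x (delta_mx 0 i)).
by rewrite derive_id => /matrixP/(_ 0 (lshift n j)) ->; rewrite mxE.
Qed.
Definition cotangent_proj : smooth_map cotangent M :=
  SmoothMap cotangent_proj_subproof.
End Cotangent.

Section Connections.
Context {R : realType} {n : nat} {M : atlas R n}.

Record affine_connection := AffineConnection {
  nabla :> vfield M -> vfield M -> vfield M;
  nabla_tens : forall (f : 'C^oo(M)) X Y Z,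
    nabla (f *: X + Y) Z = f *: nabla X Z + nabla Y Z;
  nablaD : forall X Y Z, nabla X (Y + Z) = nabla X Y + nabla X Z;
  nabla_leibniz : forall (f : 'C^oo(M)) X Y,
    nabla X (f *: Y) = f *: nabla X Y + (X f : 'C^oo(M)) *: Y
}.

Definition flat_connection (D : affine_connection) : Prop :=
  forall X Y Z, D X (D Y Z) - D Y (D X Z) - D (lie X Y) Z = 0.

Fact dual_connection_subproof (D : affine_connection) (X : vfield M)
    (a : form1 M) :
  (fun Z => X (a Z) - a (D X Z) : 'C^oo(M)^o) \in @tensorial _ _ M.
Proof.
apply/asboolP => f Y Z.
by rewrite nablaD nabla_leibniz !form1D !form1Z vfieldD vfieldM; ring.
Qed.
Definition dual_connection (D : affine_connection) (X : vfield M)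
    (a : form1 M) : form1 M :=
  Form1 (dual_connection_subproof D X a).

(* [s] is the section of the cotangent bundle given by the 1-form [a]. *)
Definition is_section_of (a : form1 M) (s : smooth_map M (cotangent M)) : Prop :=
  forall x, projT1 (s x) = x /\
    forall Z : vfield M, projT2 (s x) (vfield_at Z (projT1 (s x))) = a Z x.

(* A tangent vector of the cotangent bundle at [xi] is horizontal for the
   connection [D] when it is the image of a tangent vector [V_x] of [M] by (the
   tangent map of) some section through [xi] which is parallel at [x] in the
   direction [V_x]. *)
Definition horizontal (D : vfield M -> form1 M -> form1 M) (xi : cotangent M)
    (w : tangent (cotangent M) xi) : Prop :=
  exists (a : form1 M) (s : smooth_map M (cotangent M)) (V : vfield M),
    let x := cotangent_proj M xi in
    [/\ is_section_of a s, s x = xi, forall Z, D V a Z x = 0 &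
        forall F, w F = pushforward s (vfield_at V x) F].

Definition is_horizontal_lift (D : affine_connection) (X : vfield M)
    (Xh : vfield (cotangent M)) : Prop :=
  forall xi : cotangent M,
    horizontal (dual_connection D) (vfield_at Xh xi) /\
    pushforward (cotangent_proj M) (vfield_at Xh xi) =
      vfield_at X (cotangent_proj M xi).
End Connections.
Arguments affine_connection {R n} M.

(* The structure maps of a Courant algebroid over [M], on the module of
   sections of the underlying vector bundle.  Their axioms do not occur in the
   definition of an action and are not recorded. *)
Record courant_structure (R : realType) (n : nat) (M : atlas R n) :=
  CourantStructure {
  sections :> lmodType 'C^oo(M);
  pairing : sections -> sections -> 'C^oo(M);
  anchor : sections -> vfield M;
  bracket : sections -> sections -> sections
}.

(* The exact Courant algebroid on TM + T*M twisted by [H] (which must be closed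
   for the Jacobi identity); the bracket of X + a and Y + b is
   [X, Y] + L_X b - i_Y da + i_Y i_X H. *)
Section ExactCourant.
Context {R : realType} {n : nat} {M : atlas R n}.
Implicit Types a b : (vfield M * form1 M)%type.

Definition exact_pairing a b : 'C^oo(M) := a.2 b.1 + b.2 a.1.

Definition exact_bracket (H : form3 M) a b : (vfield M * form1 M)%type :=
  (lie a.1 b.1,
   lie_derivative a.1 b.2 - contract2 b.1 (d1 a.2)
   + contract2 b.1 (contract3 a.1 H)).

Definition exact_courant (H : form3 M) : courant_structure M :=
  @CourantStructure R n M (vfield M * form1 M)%type exact_pairing fst
    (exact_bracket H).
End ExactCourant.

Record courant_action (R : realType) (m n : nat) (M : atlas R n)
    (E : courant_structure M) (M' : atlas R m) (Phi : smooth_map M' M)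
    (rho : E -> vfield M') : Prop := {
  (* [cotangent M] is only given as an atlas, so the axioms are required here *)
  action_manifold : is_manifold M';
  action_linear : forall (c : R) (a b : E),
    rho (constf c *: a + b) = constf c *: rho a + rho b;
  action_anchor : forall (a : E) (q : M'),
    pushforward Phi (vfield_at (rho a) q) = vfield_at (anchor a) (Phi q);
  action_module : forall (f : 'C^oo(M)) (a : E),
    rho (f *: a) = pullback Phi f *: rho a;
  action_bracket : forall a b : E,
    lie (rho a) (rho b) = rho (bracket a b)
}.

(* Main.v *)
Require Import Defs.
From mathcomp Require Import all_boot all_order all_algebra.
From mathcomp Require Import all_classical all_reals all_analysis.
From mathcomp Require Import ring lra.
Import numFieldNormedType.Exports.
Import Order.TTheory GRing.Theory Num.Theory.

(** The horizontal lift of [X] is characterised by its action on two families of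
    functions on the cotangent bundle: it sends the pullback [base_fun f] of a
    function to the pullback of [X f], because it projects to [X], and it sends the
    function [fibre_lin Z : xi |-> xi (Z)] to [fibre_lin (nabla X Z)], because along
    a section [a] parallel at a point [X (a Z) = a (nabla X Z)] there
    ([horizontal_lift_base_fun], [horizontal_lift_fibre_lin]).  Near each point
    these functions contain coordinates, so a vector field on the cotangent bundle
    is determined by its values on them ([cotangent_vfield_eq]).  Hence horizontal
    lifts are unique and depend linearly over functions on [X], and the bracket
    axiom, where only the vector field part [lie X Y] of the Courant bracket is
    lifted, is a computation: both sides send [base_fun f] to the pullback of
    [lie X Y f], and on [fibre_lin Z] the commutator of the lifts of [X] and [Y]
    gives [nabla X (nabla Y Z) - nabla Y (nabla X Z)], which flatness identifies
    with [nabla (lie X Y) Z].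

    What remains is differential topology for tangent vectors defined as
    derivations.  Smooth bump functions on Euclidean space and the Hausdorff axiom
    give cut-off functions on a manifold ([bump_at]), which make derivations and
    tensors local ([tangent_local], [tensor_coordinates]) and replace chart
    coordinates and coordinate fields by global functions and fields
    ([local_coordinates]).  Hadamard's lemma ([hadamard]) shows that a derivation at
    a point is the combination of partial derivatives given by its values on the
    coordinates ([tangent_coordinates]).  With this the charts of the cotangent
    bundle are seen to be injective with smooth transition maps, and the bundle is a
    manifold ([cotangent_manifold]); and each covector extends to a section parallel
    at its base point ([parallel_section]), which gives existence of the horizontal
    lift ([horizontal_lift_exists]). *)

Set Implicit Arguments.
Unset Strict Implicit.
Unset Printing Implicit Defensive.

Local Open Scope classical_set_scope.
Local Open Scope ring_scope.

(** * Bump functions *)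

Section Flat.
Context {R : realType}.
Implicit Types (x : R) (m n k : nat).

(** The whole family is needed to prove [flat 0] smooth: differentiating
    [x ^- m * exp (- 1/x)] gives a combination of its successors. *)
Definition flat m x : R := if 0 < x then x ^- m * expR (- x^-1) else 0.

Lemma flat_le0 m x : x <= 0 -> flat m x = 0.
Proof. by rewrite /flat ltNge => ->. Qed.

Lemma flat_gt0 m x : 0 < x -> 0 < flat m x.
Proof. by rewrite /flat => x0; rewrite x0 mulr_gt0 ?expR_gt0// invr_gt0 exprn_gt0. Qed.

Lemma flatS m x : 0 < x -> flat m.+1 x = x^-1 * flat m x.
Proof. by rewrite /flat => ->; rewrite exprS invfM mulrA. Qed.

(** The term of degree [m + 1] in the exponential series at [1/x] bounds
    [exp (1/x)] from below.  Since [flat m x / x] is [flat m.+1 x], this bound is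
    what makes [flat m] differentiable at 0. *)
Lemma flat_bound m x : 0 < x -> flat m x <= (m.+1)`!%:R * x.
Proof.
move=> x0; rewrite /flat x0 expRN.
have y0 : 0 < x^-1 by rewrite invr_gt0.
have := @expR_ge1Dxn R x^-1 m (ltW y0).
set F := _%:R; have F0 : 0 < F :> R by rewrite ltr0n fact_gt0.
move=> H.
have {}H : x ^- m.+1 / F <= expR x^-1.
  by rewrite -exprVn; apply: le_trans H; rewrite lerDr.
rewrite ler_pdivrMr ?expR_gt0//.
apply: le_trans (_ : F * x * (x ^- m.+1 / F) <= _); last first.
  by rewrite ler_pM2l// mulr_gt0.
have -> : F * x * (x ^- m.+1 / F) = (F / F) * (x / x) * x ^- m.
  by rewrite exprS invfM; ring.
by rewrite !divff ?gt_eqF// !mul1r.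
Qed.

Lemma is_derive_flat m x :
  is_derive x 1 (flat m) (flat m.+2 x - m%:R * flat m.+1 x).
Proof.
have [x0|x0|->] := ltgtP x 0.
- rewrite !flat_le0 ?ltW// mulr0 subr0.
  apply: (@near_eq_is_derive _ _ _ (cst 0)).
  by near=> y; rewrite flat_le0//; apply: ltW; near: y; exact: lt_nbhsl.
- pose g (y : R) := (y ^- m) * expR (- y^-1).
  apply: (@near_eq_is_derive _ _ _ g).
    by near=> y; rewrite /flat ifT//; near: y; exact: lt_nbhsr.
  have xn0 : x != 0 by rewrite gt_eqF.
  have dV : is_derive x 1 (fun y : R => y^-1) (- x ^- 2).
    split; first exact: derivableV.
    by rewrite deriveV// derive_id /GRing.scale /= mulr1.
  have dE : is_derive x 1 (fun y : R => expR (- y^-1)) (x ^- 2 * expR (- x^-1)).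
    have dN : is_derive x 1 (fun y : R => - y^-1) (x ^- 2).
      by apply: is_derive_eq; rewrite opprK.
    by apply: (is_derive_eq (is_derive1_comp _ dN)); rewrite mulrC.
  have dX : is_derive x 1 ((fun y : R => y^-1) ^+ m) ((m%:R * x^-1 ^+ m.-1) *: - x ^- 2).
    exact: is_deriveX.
  have -> : g = ((fun y : R => y^-1) ^+ m) * (fun y => expR (- y^-1)).
    by apply/funext => y; rewrite /g !fctE exprVn.
  apply: is_derive_eq; rewrite !fctE /flat x0 /GRing.scale /= exprVn.
  case: m {g dX} => [|m]; first by ring.
  by rewrite -?exprVn !exprS; field.
- rewrite !(flat_le0 _ (lexx 0)) mulr0 subr0.
  have cf : (fun h => h^-1 *: (flat m (h *: 1 + 0) - flat m 0)) @ 0^' --> (0 : R).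
    apply/cvgrPdist_le => e e0; near=> h.
    rewrite sub0r normrN (flat_le0 _ (lexx 0)) subr0 addr0 /GRing.scale /= mulr1.
    have [h0|h0] := leP h 0; first by rewrite flat_le0// mulr0 normr0 ltW.
    rewrite -flatS// ger0_norm; last exact/ltW/flat_gt0.
    apply: (le_trans (flat_bound _ h0)).
    rewrite mulrC -ler_pdivlMr; last by rewrite ltr0n fact_gt0.
    rewrite -[leLHS]gtr0_norm// ltW//.
    near: h; apply: dnbhs0_lt; rewrite divr_gt0// ltr0n fact_gt0.
  by split; [apply/cvg_ex; exists 0|exact/cvg_lim].
Unshelve. all: by end_near. Qed.
End Flat.
Lemma flat0_le {R : realType} : {homo @flat R 0 : x y / x <= y}.
Proof.
move=> x y xy; have [x0|x0] := leP x 0.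
  rewrite (flat_le0 _ x0); have [y0|y0] := leP y 0; first by rewrite flat_le0.
  exact/ltW/flat_gt0.
have y0 := lt_le_trans x0 xy.
by rewrite /flat x0 y0 !expr0 invr1 !mul1r ler_expR lerN2 lef_pV2.
Qed.

Section SmoothCalculus.
Context {R : realType}.

Section Open.
Variables (n : nat) (W : set 'rV[R]_n).
Hypothesis oW : open W.
Implicit Types f g : 'rV[R]_n -> R.

Lemma smooth_eq f g : (forall x, W x -> f x = g x) -> smooth_on W f -> smooth_on W g.
Proof. by move=> fg sf k; exact: (Ck_ext oW fg (sf k)). Qed.

Lemma smoothD f g : smooth_on W f -> smooth_on W g -> smooth_on W (f + g).
Proof. by move=> sf sg k; exact: CkD. Qed.

Lemma smoothM f g : smooth_on W f -> smooth_on W g -> smooth_on W (f * g).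
Proof. by move=> sf sg k; exact: CkM. Qed.

Lemma smooth_sum p (f : 'I_p -> 'rV[R]_n -> R) :
  (forall j, smooth_on W (f j)) -> smooth_on W (\sum_(j < p) f j).
Proof. by move=> sf k; apply: Ck_sum => // j; exact: sf. Qed.

(** The induction on the order of differentiability treats all [m] at once,
    because the derivative of [flat m] involves [flat m.+1] and [flat m.+2]. *)
Lemma smooth_flat m g : smooth_on W g -> smooth_on W (flat m \o g).
Proof.
move=> sg k; elim: k m => [|k IH] m.
  move=> x Wx; apply: continuous_comp; first exact: (sg 0).
  apply/differentiable_continuous/derivable1_diffP.
  by have [] := is_derive_flat m (g x).
have [dg Dg] := sg k.+1.
have df y : differentiable (@flat R m) y.
  by apply/derivable1_diffP; have [] := is_derive_flat m y.
split=> [x Wx|i]; first by apply: differentiable_comp; [exact: (sg 1).1|exact: df].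
pose F := ((flat m.+2 \o g) + cst (- m%:R) * (flat m.+1 \o g)) * 'D_(delta_mx 0 i) g.
apply: (@Ck_ext _ _ _ oW k F) => [x Wx|].
  have dgx := (sg 1).1 _ Wx.
  rewrite (deriveE _ (differentiable_comp dgx (df _))) diff_comp//= -(deriveE _ dgx).
  rewrite deriv1E; last exact/derivable1_diffP.
  rewrite derive1E.
  rewrite (@derive_val _ _ _ _ _ _ _ (is_derive_flat m (g x))).
  by rewrite /F !fctE /= mulNr mulrC.
apply: CkM => //; last exact: Dg.
by apply: CkD => //; apply: CkM => //; exact: Ck_cst.
Qed.

End Open.

Lemma smooth_sub n (V W : set 'rV[R]_n) g : V `<=` W -> smooth_on W g -> smooth_on V g.
Proof. by move=> VW sg k; exact: sub_Ck (sg k). Qed.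

Lemma smooth_local n (W : set 'rV[R]_n) g :
  (forall x, W x -> exists V, V x /\ smooth_on V g) -> smooth_on W g.
Proof.
move=> H k; apply: Ck_local => x /H[V [Vx sg]]; exists V; split=> //; exact: sg.
Qed.

Lemma smooth_derive n (W : set 'rV[R]_n) g i :
  smooth_on W g -> smooth_on W ('D_(delta_mx 0 i) g).
Proof. by move=> sg k; exact: (sg k.+1).2. Qed.

Lemma smooth_differentiable n (W : set 'rV[R]_n) g x :
  smooth_on W g -> W x -> differentiable g x.
Proof. by move=> sg; exact: (sg 1).1. Qed.

Lemma smooth_continuous n (W : set 'rV[R]_n) g x :
  smooth_on W g -> W x -> {for x, continuous g}.
Proof. by move=> sg; exact: (sg 0). Qed.

Lemma derive_coord n (i j : 'I_n) (x : 'rV[R]_n) :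
  'D_(delta_mx 0 i) (fun u : 'rV[R]_n => u 0 j) x = (i == j)%:R.
Proof.
have := derive_mx (@derivable_id R 'rV[R]_n x (delta_mx 0 i)).
by rewrite derive_id => /matrixP/(_ 0 j); rewrite !mxE eqxx /= eq_sym => <-.
Qed.

Lemma smooth_coord n (W : set 'rV[R]_n) j :
  open W -> smooth_on W (fun u : 'rV[R]_n => u 0 j).
Proof.
move=> oW [|k]; first by move=> x _; exact: coord_continuous.
split=> [x _|i]; first exact: differentiable_coord.
apply: (Ck_ext oW _ (Ck_cst oW k (i == j)%:R)) => x _.
by rewrite derive_coord.
Qed.

(** Let [q] be the squared Euclidean distance to [u0].  The function
    [flat 0 (c - flat 0 (q - rho/2))] is constant where [q <= rho/2], as the inner
    [flat] vanishes there, and it vanishes as soon as [flat 0 (q - rho/2) >= c];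
    the choice [c = flat 0 (rho/2)] puts this region at [q >= rho]. *)
Lemma smooth_bump n (W : set 'rV[R]_n) u0 : open W -> W u0 ->
  exists (phi : 'rV[R]_n -> R) (K V : set 'rV[R]_n),
    [/\ smooth_on setT phi, compact K /\ K `<=` W, forall u, ~ K u -> phi u = 0,
        open V /\ V u0 & forall u, V u -> phi u = 1].
Proof.
move=> oW Wu0.
have /nbhs_ballP[e /= e0 eW] : nbhs u0 W by exact: open_nbhs_nbhs.
pose q (u : 'rV[R]_n) : R := \sum_i (u 0 i - u0 0 i) ^+ 2.
pose rho : R := (e / 2) ^+ 2.
have rho0 : 0 < rho by rewrite exprn_gt0// divr_gt0.
have sq : smooth_on setT q.
  have -> : q = \sum_i ((fun u : 'rV[R]_n => u 0 i) + cst (- u0 0 i)) *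
                ((fun u : 'rV[R]_n => u 0 i) + cst (- u0 0 i)).
    by apply/funext => u; rewrite fct_sumE; apply: eq_bigr => i _; rewrite expr2.
  have sl i : smooth_on setT ((fun u : 'rV[R]_n => u 0 i) + cst (- u0 0 i)).
    by apply: smoothD; [exact: openT|exact/smooth_coord/openT|exact/smooth_cst/openT].
  by apply: smooth_sum => [|i]; [exact: openT|apply: smoothM => //; exact: openT].
have cq : continuous q by move=> u; exact: (smooth_continuous sq).
have qb u : q u <= rho -> ball u0 e u.
  move=> qu; split=> // i j; rewrite ord1 /ball /= distrC.
  have : (u 0 j - u0 0 j) ^+ 2 <= rho.
    apply: le_trans qu; rewrite /q (bigD1 j)//= lerDl.
    by apply: sumr_ge0 => k _; exact: sqr_ge0.
  rewrite -real_normK ?num_real// ler_pXn2r ?nnegrE ?normr_ge0 ?divr_ge0// ?(ltW e0)//.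
  by move=> H; apply: le_lt_trans H _; rewrite ltr_pdivrMr// ltr_pMr// ltr1n.
pose c : R := flat 0 (rho / 2).
have c0 : 0 < c by apply: flat_gt0; rewrite divr_gt0.
pose phi u := flat 0 (c - flat 0 (q u - rho / 2)) / flat 0 c.
exists phi, [set u | q u <= rho], [set u | q u < rho / 2]; split.
- have -> : phi = (flat 0 \o (cst c + cst (-1) *
      (flat 0 \o (q + cst (- (rho / 2)))))) * cst (flat 0 c)^-1.
    by apply/funext => u; rewrite /phi !fctE /= mulN1r.
  have oT := @openT 'rV[R]_n.
  apply: smoothM => //; last exact: smooth_cst.
  apply: smooth_flat => //; apply: smoothD => //; first exact: smooth_cst.
  apply: smoothM => //; first exact: smooth_cst.
  by apply: smooth_flat => //; apply: smoothD => //; exact: smooth_cst.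
- split; last by move=> u /= /qb /eW.
  apply: bounded_closed_compact.
    exists (`|u0| + e); split=> [|M eM u /qb]; first exact: num_real.
    rewrite -ball_normE /= => ue; apply: le_trans (ltW eM).
    by rewrite -lerBlDl (le_trans (lerB_dist _ _))// distrC ltW.
  by apply: (closed_comp (f := q) (D := [set x | x <= rho])) => //; exact: closed_le.
- move=> u /= /negP; rewrite -ltNge => qu.
  rewrite /phi (@flat_le0 _ _ (c - _)) ?mul0r// subr_le0.
  by apply: flat0_le; rewrite lerBrDr -splitr ltW.
- split.
    by apply: (open_comp (f := q) (D := [set x | x < rho / 2])) => //; exact: open_lt.
  by rewrite /= /q big1 ?divr_gt0// => i _; rewrite subrr expr0n.
- move=> u /= /ltW qu; rewrite /phi (@flat_le0 _ _ (q u - _)) ?subr_le0// subr0.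
  by rewrite divff// gt_eqF// flat_gt0.
Qed.

End SmoothCalculus.
(** * Hadamard's lemma *)

Section UnitIntegral.
Context {R : realType}.
Implicit Types (f g : R -> R).

Definition int01 f : R := \int[@lebesgue_measure R]_(t in `[0, 1]) f t.

Lemma integrable01 f : continuous f ->
  (@lebesgue_measure R).-integrable `[0, 1] (EFin \o f).
Proof.
move=> cf; apply: continuous_compact_integrable; first exact: segment_compact.
exact: continuous_subspaceT.
Qed.

Lemma int01D f g : continuous f -> continuous g -> int01 (f + g) = int01 f + int01 g.
Proof. by move=> cf cg; apply: RintegralD => //; exact: integrable01. Qed.

Lemma int01Z (c : R) f : continuous f -> int01 (cst c * f) = c * int01 f.
Proof. by move=> cf; apply: RintegralZl => //; exact: integrable01. Qed.

Lemma int01_cst (c : R) : int01 (cst c) = c.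
Proof.
rewrite /int01 Rintegral_cst//= lebesgue_measure_itv/= lte_fin ltr01.
by rewrite oppr0 adde0 mulr1.
Qed.

Lemma int01_sum n (f : 'I_n -> R -> R) : (forall i, continuous (f i)) ->
  int01 (\sum_i f i) = \sum_i int01 (f i).
Proof.
move=> cf.
suff [] : continuous (\sum_i f i) /\ int01 (\sum_i f i) = \sum_i int01 (f i) by [].
elim/big_ind2 : _ => [|x1 x2 y1 y2 [cx ex] [cy ey]|i _].
- by split; [exact: cst_continuous|exact: (int01_cst 0)].
- split; last by rewrite int01D// ex ey.
  by move=> t; apply: continuousD; [exact: cx|exact: cy].
- by split.
Qed.

Lemma int01_bound f C : continuous f -> (forall t, 0 <= t <= 1 -> `|f t| <= C) ->
  `|int01 f| <= C.
Proof.
move=> cf fC; apply: le_trans (le_normr_Rintegral _ (integrable01 cf)) _ => //.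
rewrite -[leRHS]int01_cst; apply: le_Rintegral => //.
- apply: (@integrable01 (fun t => `|f t|)) => t.
  by apply: continuous_comp; [exact: cf|exact: norm_continuous].
- by apply: integrable01 => t; exact: cst_continuous.
Qed.

Lemma int01_derive f (F : R -> R) : continuous f ->
    (forall t : R, is_derive t 1 F (f t)) ->
  int01 f = F 1 - F 0.
Proof.
move=> cf dF.
have cF : continuous F.
  by move=> t; apply/differentiable_continuous/derivable1_diffP; have [] := dF t.
apply: EFin_inj; rewrite EFinB -(@continuous_FTC2 R f)//.
- rewrite /int01 /Rintegral fineK//.
  by apply: integrable_fin_num => //; exact: integrable01.
- exact: continuous_subspaceT.
- split=> [t _||]; first by have [] := dF t.
    exact/cvg_at_right_filter/cF.
  exact/cvg_at_left_filter/cF.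
- by move=> t _; rewrite derive1E (@derive_val _ _ _ _ _ _ _ (dF t)).
Qed.

End UnitIntegral.

Section Quadratic.
Context {R : realType} {n : nat}.
Implicit Types (f g : 'rV[R]_n -> R) (x h : 'rV[R]_n).

Lemma quadratic_differentiable0 f x C :
  (\forall h \near (0 : 'rV[R]_n), `|f (h + x) - f x| <= C * `|h| ^+ 2) ->
  differentiable f x /\ forall v, 'D_v f x = 0.
Proof.
move=> H; pose z : {linear 'rV[R]_n -> R} := \0.
have cz : continuous z by exact: cst_continuous.
have fE : f \o shift x = cst (f x) + (z : 'rV[R]_n -> R) +o_ (0 : 'rV[R]_n) id.
  apply/eqaddoP => e e0.
  have C0 : 0 < `|C| + 1 by rewrite ltr_wpDl.
  near=> h; rewrite !fctE /= addr0.
  have He : `|f (h + x) - f x| <= C * `|h| ^+ 2 by near: h.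
  apply: (le_trans He); rewrite expr2 mulrA ler_wpM2r//.
  apply: (@le_trans _ _ ((`|C| + 1) * `|h|)).
    by rewrite ler_wpM2r// (le_trans (ler_norm _))// lerDl.
  rewrite mulrC -ler_pdivlMr// ltW//; near: h.
  by apply: (@nbhs0_lt R 'rV[R]_n); rewrite divr_gt0.
have dE : 'd f x = z :> (_ -> _) by exact: diff_unique.
have df : differentiable f x by apply/diff_locallyP; rewrite dE.
by split=> // v; rewrite deriveE// dE.
Unshelve. all: by end_near. Qed.

(** A first-order expansion with quadratic error identifies the derivative.
    This form of differentiability can be obtained by integrating an estimate,
    which is how integrals depending on a parameter are differentiated below. *)
Lemma quadratic_differentiable f x (a : 'I_n -> R) C :
  (\forall h \near (0 : 'rV[R]_n),
     `|f (h + x) - f x - \sum_i a i * h 0 i| <= C * `|h| ^+ 2) ->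
  differentiable f x /\ forall i, 'D_(delta_mx 0 i) f x = a i.
Proof.
move=> H.
pose L : 'rV[R]_n -> R := \sum_i a i *: (fun u : 'rV[R]_n => u 0 i).
have LE u : L u = \sum_i a i * u 0 i by rewrite /L fct_sumE.
have dc i : differentiable (fun u : 'rV[R]_n => u 0 i : R) x by
    exact: differentiable_coord.
have dL : differentiable L x.
  by apply: differentiable_sum => i; exact: differentiableZ.
have [|dg Dg] := @quadratic_differentiable0 (f - L) x C.
  apply: filterS H => h; rewrite !fctE !LE.
  have -> : \sum_i a i * (h + x) 0 i = \sum_i a i * h 0 i + \sum_i a i * x 0 i.
    by rewrite -big_split; apply: eq_bigr => i _; rewrite mxE mulrDr.
  by congr (`| _ | <= _); ring.
have fE : f = (f - L) + L by rewrite subrK.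
split=> [|i]; first by rewrite fE; exact: differentiableD.
rewrite fE deriveD; [|exact: diff_derivable|exact: diff_derivable].
rewrite Dg add0r derive_sum => [|j]; last exact/derivableZ/diff_derivable.
rewrite (bigD1 i)//= big1 => [|j ji]; rewrite deriveZ ?derive_coord.
- by rewrite eqxx addr0 /GRing.scale /= mulr1.
- exact: diff_derivable.
- by rewrite eq_sym (negbTE ji) scaler0.
- exact: diff_derivable.
Qed.

Lemma is_derive_line f a h t : differentiable f (a + t *: h) ->
  is_derive t 1 (fun s : R => f (a + s *: h))
    (\sum_i 'D_(delta_mx 0 i) f (a + t *: h) * h 0 i).
Proof.
move=> df.
have -> : \sum_i 'D_(delta_mx 0 i) f (a + t *: h) * h 0 i = 'D_h f (a + t *: h).
  move: df; move: (a + t *: h) => y dfy.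
  rewrite [in RHS](row_sum_delta h) (deriveE _ dfy) linear_sum.
  by apply: eq_bigr => i _ /=; rewrite linearZ /= -(deriveE _ dfy) mulrC.
have E : (fun s => s^-1 *:
    (((fun s : R => f (a + s *: h)) \o shift t) (s *: 1) - f (a + t *: h)))
    = (fun s : R => s^-1 *: ((f \o shift (a + t *: h)) (s *: h) - f (a + t *: h))).
  apply/funext => s /=; congr (_ *: (f _ - _)).
  by rewrite /GRing.scale /= mulr1 -/(GRing.scale _ _) scalerDl addrCA addrA.
have dh : derivable f (a + t *: h) h by exact: diff_derivable.
split; first by rewrite /derivable E.
by rewrite /derive E.
Qed.

Lemma line_lipschitz f a h B c : (forall x, differentiable f x) -> 0 <= c ->
  (forall t, 0 <= t <= c -> `|\sum_i 'D_(delta_mx 0 i) f (a + t *: h) * h 0 i| <= B) ->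
  `|f (a + c *: h) - f a| <= B * c.
Proof.
move=> df c0 HB.
have dl t := is_derive_line (df (a + t *: h)).
have [|s] := MVT_segment c0 (fun t _ => dl t).
  by apply: derivable_within_continuous => t _; have [] := dl t.
rewrite in_itv /= => s0c; rewrite scale0r addr0 => ->.
by rewrite subr0 normrM (ger0_norm c0) ler_wpM2r// HB.
Qed.

(** The mean value theorem, once for [f] and once for its partial derivatives,
    on the segment from [x] to [x + h]; the segment stays in the ball by convexity
    and the second partial derivatives are bounded there by compactness. *)
Lemma taylor_quadratic f u0 (r : R) : smooth_on setT f ->
  exists C, forall x h, `|x - u0| <= r -> `|x + h - u0| <= r ->
    `|f (x + h) - f x - \sum_i 'D_(delta_mx 0 i) f x * h 0 i| <= C * `|h| ^+ 2.
Proof.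
move=> sf.
pose K := [set x : 'rV[R]_n | `|x - u0| <= r].
have cK : compact K.
  apply: bounded_closed_compact.
    exists (`|u0| + r); split=> [|M eM u /= ue]; first exact: num_real.
    by apply: le_trans (ltW eM); rewrite -lerBlDl (le_trans (lerB_dist _ _)).
  apply: (closed_comp (f := fun x => `|x - u0|) (D := [set x | x <= r]));
      last exact: closed_le.
  move=> x _; apply: continuous_comp; last exact: norm_continuous.
  by apply: continuousB; [exact: id|exact: cst_continuous].
have s1 i := smooth_derive i sf.
have s2 i j := smooth_derive j (s1 i).
have HC i j : exists C, forall x, K x -> `|'D_(delta_mx 0 j) ('D_(delta_mx 0 i) f) x| <=
    C.
  have : compact ('D_(delta_mx 0 j) ('D_(delta_mx 0 i) f) @` K).
    apply: continuous_compact => //; apply: continuous_subspaceT => x.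
    exact: (smooth_continuous (s2 i j)).
  move=> /compact_bounded[C [_ HC]]; exists (C + 1) => x Kx.
  by apply: (HC (C + 1)); [rewrite ltrDl|exists x].
have [C2 {}HC] := choice (fun ij : 'I_n * 'I_n => HC ij.1 ij.2).
pose C i j := C2 (i, j).
have {}HC i j y : K y -> `|'D_(delta_mx 0 j) ('D_(delta_mx 0 i) f) y| <= C i j by
    exact: (HC (i, j)).
exists (\sum_i \sum_j C i j) => x h xr xhr.
have nh i : `|h 0 i| <= `|h|.
  by rewrite [leRHS]/Num.norm /= mx_normrE; apply/bigmax_geP; right => /=;
      exists (ord0, i).
have Kseg t : 0 <= t <= 1 -> K (x + t *: h).
  move=> /andP[t0 t1]; rewrite /K /=.
  have -> : x + t *: h - u0 = (1 - t) *: (x - u0) + t *: (x + h - u0).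
    by apply/rowP => i; rewrite !mxE; ring.
  apply: le_trans (ler_normD _ _) _; rewrite !normrZ !ger0_norm ?subr_ge0//.
  have := ler_wpM2l t0 xhr; have : (1 - t) * `|x - u0| <= (1 - t) * r by
      rewrite ler_wpM2l ?subr_ge0.
  by lra.
have df y := smooth_differentiable sf (I : setT y).
have ds1 i y := smooth_differentiable (s1 i) (I : setT y).
have dl t := is_derive_line (df (x + t *: h)).
have [|s] := MVT_segment ler01 (fun t _ => dl t).
  by apply: derivable_within_continuous => t _; have [] := dl t.
rewrite in_itv /= => /andP[s0 s1']; rewrite scale0r scale1r addr0 subr0 mulr1 => ->.
rewrite -sumrB mulr_suml; apply: le_trans (ler_norm_sum _ _ _) _.
apply: ler_sum => i _; rewrite -mulrBl normrM expr2 mulrA.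
apply: ler_pM => //.
have HB : forall t, 0 <= t <= s ->
   `|\sum_j 'D_(delta_mx 0 j) ('D_(delta_mx 0 i) f) (x + t *: h) * h 0 j| <=
       (\sum_j C i j) * `|h|.
  move=> t /andP[t0 ts]; rewrite mulr_suml; apply: le_trans (ler_norm_sum _ _ _) _.
  apply: ler_sum => j _; rewrite normrM; apply: ler_pM => //.
  by apply/HC/Kseg; rewrite t0 (le_trans ts).
apply: le_trans (line_lipschitz (ds1 i) s0 HB) _.
rewrite ler_piMr//.
by apply: le_trans (HB 0 _); rewrite ?lexx ?s0.
Qed.

End Quadratic.
Section Hadamard.
Context {R : realType} {n : nat}.
Implicit Types (G : 'rV[R]_n -> R) (u : 'rV[R]_n).

(** The weight [t ^+ m] is there because each differentiation of
    [u |-> G (u0 + t *: (u - u0))] brings out a factor [t]. *)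
Definition ray_int (u0 : 'rV[R]_n) m G u : R :=
    int01 (fun t => t ^+ m * G (u0 + t *: (u - u0))).

Lemma ray_continuous u0 m u G : smooth_on setT G ->
  continuous (fun t : R => t ^+ m * G (u0 + t *: (u - u0))).
Proof.
move=> sG t; apply: cvgM; first exact: exprn_continuous.
apply: (@continuous_comp _ _ _ (fun t : R => u0 + t *: (u - u0)) G).
  by apply: cvgD; [exact: cvg_cst|exact: scalel_continuous].
exact: (smooth_continuous sG).
Qed.

(** Differentiation under the integral sign: the quadratic Taylor estimate holds
    along the whole ray with one constant, so it survives integration over [t]. *)
Lemma ray_int_derive u0 m G u : smooth_on setT G ->
  differentiable (ray_int u0 m G) u /\
  forall i, 'D_(delta_mx 0 i) (ray_int u0 m G) u =
            ray_int u0 m.+1 ('D_(delta_mx 0 i) G) u.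
Proof.
move=> sG; have [C HC] := taylor_quadratic u0 (`|u - u0| + 1) sG.
apply: (@quadratic_differentiable _ _ _ _ _ `|C|).
near=> h.
have h1 : `|h| <= 1 by rewrite ltW//; near: h; exact: (@nbhs0_lt R 'rV[R]_n _ ltr01).
pose A v := fun t : R => t ^+ m * G (u0 + t *: (v - u0)).
pose S i := fun t : R => t ^+ m.+1 * 'D_(delta_mx 0 i) G (u0 + t *: (u - u0)).
have cA v : continuous (A v) by exact: ray_continuous.
have cS i : continuous (S i) by apply: (ray_continuous (smooth_derive i sG)).
pose L := \sum_i cst (h 0 i) * S i.
have cSh i : continuous (cst (h 0 i) * S i).
  by move=> t; apply: continuousM; [exact: cst_continuous|exact: cS].
have cL : continuous L.
  rewrite /L; elim/big_ind : _ => [|f g cf cg|i _]; first exact: cst_continuous.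
    by move=> t; apply: continuousD; [exact: cf|exact: cg].
  exact: cSh.
(* [Q] is the remainder of the Taylor expansion, as a function of [t] *)
pose Q := A (h + u) - (A u + L).
have cAL : continuous (A u + L).
  by move=> t; apply: continuousD; [exact: cA|exact: cL].
have cQ : continuous Q by move=> t; apply: continuousB; [exact: cA|exact: cAL].
have -> : ray_int u0 m G (h + u) - ray_int u0 m G u -
   \sum_i ray_int u0 m.+1 ('D_(delta_mx 0 i) G) u * h 0 i = int01 Q.
  have AE : A (h + u) = (A u + L) + Q by rewrite /Q subrKC.
  have LE : int01 L = \sum_i int01 (S i) * h 0 i.
    rewrite /L int01_sum//; apply: eq_bigr => i _.
    by rewrite (int01Z _ (cS i)) mulrC.
  rewrite /ray_int -/(A (h + u)) -/(A u) AE (int01D cAL cQ) (int01D (cA u) cL) LE.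
  by rewrite /S; ring.
apply: int01_bound => // t /andP[t0 t1].
have -> : Q t = t ^+ m * (G (u0 + t *: (u - u0) + t *: h) - G (u0 + t *: (u - u0))
    - \sum_i 'D_(delta_mx 0 i) G (u0 + t *: (u - u0)) * (t *: h) 0 i).
  rewrite /Q /A /L !fctE fct_sumE.
  have -> : u0 + t *: (h + u - u0) = u0 + t *: (u - u0) + t *: h.
    by apply/rowP => i; rewrite !mxE; ring.
  rewrite !mulrBr mulr_sumr opprD addrA; congr (_ - _).
  by apply: eq_bigr => i _; rewrite /S !fctE mxE exprS; ring.
rewrite normrM; apply: (@le_trans _ _ (1 * (C * `|t *: h| ^+ 2))).
  apply: ler_pM => //; first by rewrite normrX exprn_ile1// ger0_norm.
  have tb (v : 'rV[R]_n) : `|t *: v| <= `|v| by rewrite normrZ ger0_norm// ler_piMl.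
  apply: HC.
    by rewrite [u0 + _]addrC addrK (le_trans (tb _))// lerDl.
  have -> : u0 + t *: (u - u0) + t *: h - u0 = t *: (u - u0) + t *: h.
    by apply/rowP => i; rewrite !mxE; ring.
  by apply: le_trans (ler_normD _ _) _; apply: lerD => //; exact: le_trans (tb _) _.
rewrite mul1r; apply: (@le_trans _ _ (`|C| * `|t *: h| ^+ 2)).
  by rewrite ler_wpM2r ?exprn_ge0// ler_norm.
rewrite ler_wpM2l// ler_pXn2r ?nnegrE// normrZ ger0_norm// ler_piMl//.
Unshelve. all: by end_near. Qed.

Lemma ray_int_smooth u0 m G : smooth_on setT G -> smooth_on setT (ray_int u0 m G).
Proof.
move=> sG k; elim: k m G sG => [|k IH] m G sG.
  by move=> x _; apply: differentiable_continuous; have [] := ray_int_derive u0 m x sG.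
split=> [x _|i]; first by have [] := ray_int_derive u0 m x sG.
apply: (Ck_ext openT _ (IH m.+1 _ (smooth_derive i sG))) => x _.
by have [_ ->] := ray_int_derive u0 m x sG.
Qed.

(** Integrate the derivative of [t |-> G (u0 + t *: (u - u0))] over [0, 1]. *)
Lemma hadamard u0 G : smooth_on setT G ->
  exists h : 'I_n -> 'rV[R]_n -> R,
    [/\ forall i, smooth_on setT (h i), forall i, h i u0 = 'D_(delta_mx 0 i) G u0 &
        forall u, G u = G u0 + \sum_i (u 0 i - u0 0 i) * h i u].
Proof.
move=> sG; exists (fun i => ray_int u0 0 ('D_(delta_mx 0 i) G)); split=> [i|i|u].
- exact/ray_int_smooth/smooth_derive.
- rewrite /ray_int -[RHS]int01_cst; congr int01; apply/funext => t.
  by rewrite subrr scaler0 addr0 expr0 mul1r.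
have dG y := smooth_differentiable sG (I : setT y).
have dl t := is_derive_line (dG (u0 + t *: (u - u0))).
have cS i : continuous (fun t : R => t ^+ 0 * 'D_(delta_mx 0 i) G (u0 + t *: (u - u0))).
  exact: (ray_continuous (smooth_derive i sG)).
pose f := \sum_i cst ((u - u0) 0 i) *
            (fun t : R => t ^+ 0 * 'D_(delta_mx 0 i) G (u0 + t *: (u - u0))).
have cSh i : continuous (cst ((u - u0) 0 i) * (fun t : R =>
    t ^+ 0 * 'D_(delta_mx 0 i) G (u0 + t *: (u - u0)))).
  by move=> t; apply: continuousM; [exact: cst_continuous|exact: cS].
have fE : f = fun t => \sum_i 'D_(delta_mx 0 i) G (u0 + t *: (u - u0)) * (u - u0) 0 i.
  apply/funext => t; rewrite /f fct_sumE; apply: eq_bigr => i _.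
  by rewrite !fctE expr0 mul1r mulrC.
have cf : continuous f.
  rewrite /f; elim/big_ind : _ => [|f1 f2 c1 c2|i _]; first exact: cst_continuous.
    by move=> t; apply: continuousD; [exact: c1|exact: c2].
  exact: cSh.
have := @int01_derive _ f (fun t => G (u0 + t *: (u - u0))) cf.
rewrite scale0r scale1r addr0 subrKC => H.
have {}H : int01 f = G u - G u0 by apply: H => t; rewrite fE.
rewrite -[LHS](subrKC (G u0)) -H.
congr (_ + _); rewrite /f int01_sum//; apply: eq_bigr => i _.
by rewrite int01Z// !mxE.
Qed.

End Hadamard.
(** * Cut-off and locality on a manifold *)

Section SmoothMaps.
Context {R : realType}.

Lemma smooth_rV_differentiable m n (W : set 'rV[R]_m) (h : 'rV[R]_m -> 'rV[R]_n) x :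
  smooth_on_rV W h -> W x -> differentiable h x.
Proof.
move=> sh Wx; have -> : h = \sum_(j < n) (fun y => h y 0 j *: delta_mx 0 j).
  by apply/funext => y; rewrite fct_sumE -row_sum_delta.
by apply: differentiable_sum => j; apply: differentiableZl;
    exact: (smooth_differentiable (sh j)).
Qed.

Lemma open_preimage m n (W : set 'rV[R]_m) (V : set 'rV[R]_n) h :
  open W -> smooth_on_rV W h -> open V -> open (W `&` h @^-1` V).
Proof.
move=> oW sh oV; rewrite openE => x [Wx Vhx]; apply: filterI.
  exact: open_nbhs_nbhs.
apply: (differentiable_continuous (smooth_rV_differentiable sh Wx)).
exact: open_nbhs_nbhs.
Qed.

End SmoothMaps.

Section Evaluation.
Context {R : realType} {n : nat} {M : atlas R n}.

Lemma smoothf_sum (I : Type) (r : seq I) (P : pred I) (f : I -> 'C^oo(M)) (p : M) :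
  (\sum_(i <- r | P i) f i) p = \sum_(i <- r | P i) f i p.
Proof. by elim/big_rec2 : _ => // i x y _ <-. Qed.

Lemma vfield_sum (I : Type) (r : seq I) (P : pred I) (X : I -> vfield M) (f : 'C^oo(M)) :
  (\sum_(i <- r | P i) X i) f = \sum_(i <- r | P i) X i f.
Proof. by elim/big_rec2 : _ => // i x y _ <-. Qed.

Lemma vfield_eq (X Y : vfield M) : (forall f, X f = Y f) -> X = Y.
Proof. by move=> XY; apply/val_inj/funext. Qed.

Section TangentVector.
Variables (p : M) (v : tangent M p).
Implicit Types f g : 'C^oo(M).

Lemma tangent_eq (w : tangent M p) : (forall f, v f = w f) -> v = w.
Proof. by move=> vw; apply/val_inj/funext. Qed.

Let vP : tangent_val v \in @derivation_at _ _ M p. Proof. by case: v. Qed.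

Lemma tangentM f g : v (f * g) = f p * v g + g p * v f.
Proof. by have /asboolP[_] := vP; apply. Qed.

Lemma tangentD f g : v (f + g) = v f + v g.
Proof.
have /asboolP[vD _] := vP; have := vD 1 f g.
have -> : constf 1 = 1 :> 'C^oo(M) by exact: smoothfE.
by rewrite !mul1r.
Qed.

Lemma tangent0 : v 0 = 0.
Proof. by have := tangentD 0 0; rewrite addr0 => /(canLR (addrK _)); rewrite subrr. Qed.

Lemma tangentZ (c : R) f : v (constf c * f) = c * v f.
Proof. by have /asboolP[vD _] := vP; have := vD c f 0; rewrite tangent0 !addr0. Qed.

Lemma tangent_cst (c : R) : v (constf c) = 0.
Proof.
have H := tangentM 1 1; rewrite mulr1 mul1r in H.
have v1 : v 1 = 0 by move: H => /(canLR (addrK _)); rewrite subrr.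
by rewrite -[constf c]mulr1 tangentZ v1 mulr0.
Qed.

Lemma tangentB f g : v (f - g) = v f - v g.
Proof.
have -> : f - g = f + constf (-1) * g.
  by apply: smoothfE => q; rewrite !smoothfD smoothfM smoothfN mulN1r.
by rewrite tangentD tangentZ mulN1r.
Qed.

Lemma tangent_sum (I : Type) (r : seq I) (P : pred I) (f : I -> 'C^oo(M)) :
  v (\sum_(i <- r | P i) f i) = \sum_(i <- r | P i) v (f i).
Proof. by elim/big_rec2 : _ => [|i x y _ <-]; [exact: tangent0|exact: tangentD]. Qed.

End TangentVector.
End Evaluation.

(** Stated from the chart axioms it uses, so that it also serves while the
    cotangent bundle is still being shown to be a manifold. *)
Lemma open_param_overlap {R : realType} {n : nat} {M : atlas R n}
    (W : set 'rV[R]_n) (c : chart M) :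
  {in dom c &, injective (param c)} ->
  (forall d : chart M, open (overlap d c)) ->
  (forall d : chart M, exists h : 'rV[R]_n -> 'rV[R]_n,
     smooth_on_rV (overlap d c) h /\
     forall u, overlap d c u -> dom c (h u) /\ param c (h u) = param d u) ->
  open W -> W `<=` dom c -> atlas_open (param c @` W).
Proof.
move=> injc oov trans oW Wc d; have [h [sh hE]] := trans d.
have -> : dom d `&` param d @^-1` (param c @` W) = overlap d c `&` h @^-1` W.
  apply/seteqP; split => v /=.
    move=> [dv [u Wu uv]].
    have vov : overlap d c v by split=> //; exists u => //; exact: Wc.
    split=> //; have [ch hv] := hE _ vov.
    by rewrite (injc (h v) u) ?inE ?hv//; exact: Wc.
  move=> [vov Wh]; have [ch hv] := hE _ vov.
  by split; [exact: vov.1|exists (h v)].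
exact: open_preimage.
Qed.

Section ManifoldTopology.
Context {R : realType} {n : nat} {M : atlas R n}.
Hypothesis hM : is_manifold M.
Implicit Types (c d : chart M) (p q : M).

Definition chart_dom c : set M := param c @` dom c.

Lemma param_inj c u w : dom c u -> dom c w -> param c u = param c w -> u = w.
Proof. by move=> cu cw; apply: (chart_inj hM); rewrite inE. Qed.

Lemma atlas_openI (A B : set M) : atlas_open A -> atlas_open B -> atlas_open (A `&` B).
Proof.
move=> oA oB c; have := openI (oA c) (oB c).
by congr open; apply/seteqP; split => u /= [] => [[? ?] [? ?]|? [? ?]].
Qed.

Lemma open_param c (W : set 'rV[R]_n) : open W -> W `<=` dom c ->
  atlas_open (param c @` W).
Proof.
apply: open_param_overlap => [|d|d]; first exact: (chart_inj hM).
- exact: (overlap_open hM).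
- exact: (transition_smooth hM).
Qed.

Lemma chart_dom_open c : atlas_open (chart_dom c).
Proof. by apply: open_param => //; exact: dom_open. Qed.

(** The image of a compact set in a Hausdorff space is closed.  The covering form
    of compactness is applied to the filter of neighbourhoods of [q]. *)
Lemma compact_param_separated c (K : set 'rV[R]_n) q : compact K -> K `<=` dom c ->
  ~ (param c @` K) q ->
  exists A : set M, [/\ atlas_open A, A q & forall u, K u -> ~ A (param c u)].
Proof.
move=> /compact_near_coveringP cK Kc qK.
pose F : set_system M := fun S => exists A, [/\ atlas_open A, A q & A `<=` S].
have FF : Filter F.
  split.
  - exists setT; split=> // d.
    by rewrite preimage_setT setIT; exact: dom_open.
  - move=> S T [A [oA Aq AS]] [B [oB Bq BT]]; exists (A `&` B).
    split=> [||x [/AS ? /BT ?]//]; [exact: atlas_openI|by []].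
  - by move=> S T ST [A [oA Aq AS]]; exists A; split=> //; exact: subset_trans ST.
have [|A [oA Aq HA]] := cK M F (fun p u => p <> param c u) FF.
  move=> u Ku; have [|A [B [oA oB Au Bq AB]]] :=
      manifold_hausdorff hM (p := param c u) (q := q).
    by move=> e; apply: qK; exists u.
  exists (dom c `&` param c @^-1` A, B).
    split=> /=; last by exists B; split.
    by apply: open_nbhs_nbhs; split; [exact: oA|split=> //; exact: Kc].
  move=> [w p] /= [[cw Aw] Bp] e.
  by have : set0 p by rewrite -AB; split=> //; rewrite e.
by exists A; split=> // u Ku /HA/(_ _ Ku).
Qed.

Definition zero_ext c (g : 'rV[R]_n -> R) (p : M) : R :=
  if pselect (exists2 u, dom c u & param c u = p) is left H then g (projT1 (cid2 H))
  else 0.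

Lemma zero_extE c g u : dom c u -> zero_ext c g (param c u) = g u.
Proof.
move=> cu; rewrite /zero_ext; case: pselect => [H|[]]; last by exists u.
by case: cid2 => /= w cw /(param_inj cw cu) ->.
Qed.

Lemma zero_ext_out c g p : ~ chart_dom c p -> zero_ext c g p = 0.
Proof. by move=> cp; rewrite /zero_ext; case: pselect. Qed.

(** At a point outside the chart the extension vanishes on a neighbourhood,
    because the image of [K] is closed; this is where Hausdorff separation enters. *)
Lemma zero_ext_smooth c (K : set 'rV[R]_n) g : compact K -> K `<=` dom c ->
  smooth_on (dom c) g -> (forall u, dom c u -> ~ K u -> g u = 0) ->
  zero_ext c g \in @smooth_fun _ _ M.
Proof.
move=> cK Kc sg gK; apply/asboolP => d; apply: smooth_local => v dv.
have [ov|nov] := pselect (chart_dom c (param d v)).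
  have [h [sh hE]] := transition_smooth hM d c.
  have oo : open (overlap d c) by exact: (overlap_open hM).
  exists (overlap d c); split=> //.
  apply: (smooth_eq oo (f := g \o h)) => [w /hE[ch hw]|]; first by
      rewrite /= -hw zero_extE.
  by apply: (smooth_comp oo sh _ sg) => w /hE[].
have [|A [oA Aq HA]] := compact_param_separated cK Kc (q := param d v).
  by move=> [u Ku e]; apply: nov; exists u => //; exact: Kc.
exists (dom d `&` param d @^-1` A); split=> //.
apply: (smooth_eq (oA d) (f := cst 0)); last exact: smooth_cst.
move=> w [dw Aw] /=.
have [[u cu uw]|nw] := pselect (chart_dom c (param d w)); last by rewrite zero_ext_out.
rewrite -uw zero_extE// gK// => Ku; apply: (HA _ Ku); by rewrite uw.
Qed.

Lemma bump_at p (A : set M) : atlas_open A -> A p ->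
  exists psi : 'C^oo(M), psi p = 1 /\ forall q, ~ A q -> psi q = 0.
Proof.
move=> oA Ap; have [c [u cu up]] := chart_cover hM p.
have Wu : (dom c `&` param c @^-1` A) u by split=> //=; rewrite up.
have [phi [K [V [sphi [cK KW] phi0 [oV Vu] phi1]]]] := smooth_bump (oA c) Wu.
have Kc : K `<=` dom c by move=> w /KW[].
have sm := @zero_ext_smooth c K phi cK Kc (smooth_sub (@subsetT _ _) sphi)
    (fun w _ => phi0 w).
exists (SmoothF sm); split=> [|q Aq] /=; first by rewrite -up zero_extE// phi1.
have [[w cw wq]|nq] := pselect (chart_dom c q); last by rewrite zero_ext_out.
rewrite -wq zero_extE//; apply: phi0 => /KW[_] /=.
by rewrite wq.
Qed.

(** For a bump [psi] at [p] supported in [A], [psi * (f - g)] is zero, and the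
    Leibniz rule turns this into [v (f - g) = 0]. *)
Lemma tangent_local p (v : tangent M p) (A : set M) (f g : 'C^oo(M)) :
  atlas_open A -> A p -> (forall q, A q -> f q = g q) -> v f = v g.
Proof.
move=> oA Ap fg; have [psi [psi1 psi0]] := bump_at oA Ap.
have E : psi * (f - g) = 0.
  apply: smoothfE => q; rewrite smoothfM smoothfD smoothfN smoothf0.
  by have [/fg ->|/psi0 ->] := pselect (A q); rewrite ?subrr ?mulr0 ?mul0r.
apply/subr0_eq; rewrite -tangentB -[LHS]mul1r -psi1.
have := tangentM v psi (f - g); rewrite E tangent0 => H.
have fgp : (f - g) p = 0 by rewrite smoothfD smoothfN fg// subrr.
by rewrite fgp mul0r addr0 in H.
Qed.

(** Vector fields, forms and connections act on global objects only, so chart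
    coordinates are represented by global functions that agree with them on a
    smaller open set [V]; in the same way [coordinate_frame] replaces the
    coordinate vector fields by global ones. *)
Definition coordinates c (V : set 'rV[R]_n) (f : 'I_n -> 'C^oo(M)) : Prop :=
  [/\ open V, V `<=` dom c & forall w i, V w -> f i (param c w) = w 0 i].

Definition coordinate_frame c (V : set 'rV[R]_n) (E : 'I_n -> vfield M) : Prop :=
  forall w i (g : 'C^oo(M)), V w ->
    E i g (param c w) = 'D_(delta_mx 0 i) (g \o param c) w.

Lemma smooth_param c (g : 'C^oo(M)) : smooth_on (dom c) (g \o param c).
Proof. by case: g => g /= /asboolP; apply. Qed.

Lemma local_coordinates c u : dom c u ->
  exists V f E, [/\ V u, coordinates c V f & coordinate_frame c V E].
Proof.
move=> cu; have oc := @dom_open _ _ M c.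
have [phi [K [V [sphi [cK Kc] phi0 [oV Vu] phi1]]]] := smooth_bump oc cu.
have VK : V `<=` K.
  by move=> w Vw; apply: contrapT => /phi0; rewrite phi1// => /eqP; rewrite oner_eq0.
have Vc : V `<=` dom c by move=> w /VK /Kc.
have sphi' := smooth_sub (@subsetT _ (dom c)) sphi.
have smx (g : 'rV[R]_n -> R) : smooth_on (dom c) g -> zero_ext c (phi * g) \in
    @smooth_fun _ _ M.
  move=> sg; apply: (zero_ext_smooth cK Kc); first exact: smoothM.
  by move=> w _ /phi0; rewrite !fctE => ->; rewrite mul0r.
pose f i := SmoothF (smx _ (smooth_coord i oc)).
pose De i (g : 'C^oo(M)) : 'C^oo(M)^o :=
  SmoothF (smx _ (smooth_derive i (smooth_param c g))).
have df (g : 'C^oo(M)) w i : dom c w ->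
    derivable (g \o param c : 'rV[R]_n -> R) w (delta_mx 0 i).
  by move=> cw; apply: diff_derivable; exact: (smooth_differentiable (smooth_param c g)).
have DeP i : De i \in @derivation _ _ M.
  apply/asboolP; split=> [a g h|g h]; apply: smoothfE => p;
    rewrite !smoothfD !smoothfM /=;
    (have [[w cw <-]|np] := pselect (chart_dom c p);
        last by rewrite !zero_ext_out// !mulr0 addr0);
    rewrite !zero_extE// !fctE.
    rewrite -[X in phi w * X]/('D_(delta_mx 0 i) (a *: (g \o param c : 'rV[R]_n -> R) +
        (h \o param c)) w).
    rewrite deriveD ?deriveZ; [|exact: df|exact/derivableZ/df|exact: df].
    by rewrite /GRing.scale /=; ring.
  rewrite -[X in phi w * X]/('D_(delta_mx 0 i)
      ((g \o param c : 'rV[R]_n -> R) * (h \o param c)) w).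
  rewrite deriveM; [|exact: df|exact: df].
  by rewrite /GRing.scale /=; ring.
exists V, f, (fun i => VField (DeP i)); split=> //.
  by split=> // w i Vw; rewrite /= zero_extE ?fctE ?phi1 ?mul1r//; exact: Vc.
by move=> w i g Vw; rewrite /= zero_extE ?fctE ?phi1 ?mul1r//; exact: Vc.
Qed.

(** Near the point, Hadamard's lemma writes [F] as a constant plus a sum of
    products of [f i - u i], which vanishes at the point, with functions taking
    the value [d_i F] there; a derivation sees nothing else. *)
Lemma tangent_coordinates c V f u (v : tangent M (param c u)) (F : 'C^oo(M)) :
  coordinates c V f -> V u ->
  v F = \sum_i 'D_(delta_mx 0 i) (F \o param c) u * v (f i).
Proof.
move=> [oV Vc fE] Vu.
have [phi [K [V' [sphi [cK KV] phi0 [oV' V'u] phi1]]]] := smooth_bump oV Vu.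
have V'V : V' `<=` V.
  move=> w V'w; apply: KV; apply: contrapT => /phi0.
  by rewrite phi1// => /eqP; rewrite oner_eq0.
have Kc : K `<=` dom c by exact: subset_trans Vc.
have sphi' := smooth_sub (@subsetT _ (dom c)) sphi.
have oc := @dom_open _ _ M c.
have oT := @openT 'rV[R]_n.
pose G : 'rV[R]_n -> R := phi * (F \o param c).
have sG : smooth_on setT G.
  apply: smooth_local => w _; have [cw|ncw] := pselect (dom c w).
    by exists (dom c); split=> //; apply: smoothM => //; exact: smooth_param.
  have oK : open (~` K) by apply: closed_openC; exact: compact_closed.
  exists (~` K); split; first by move=> /Kc.
  apply: (smooth_eq oK (f := cst 0)); last exact: smooth_cst.
  by move=> x /phi0 phix; rewrite /G !fctE phix mul0r.
have [h [sh hu GE]] := hadamard u sG.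
have sph i : zero_ext c (phi * h i) \in @smooth_fun _ _ M.
  apply: (zero_ext_smooth cK Kc).
    by apply: smoothM => //; exact: smooth_sub (sh i).
  by move=> w _ /phi0; rewrite !fctE => ->; rewrite mul0r.
pose H i : 'C^oo(M) := SmoothF (sph i).
have V'c : V' `<=` dom c by exact: subset_trans Vc.
have HE i w : V' w -> H i (param c w) = h i w.
  by move=> V'w; rewrite /= zero_extE ?fctE ?phi1 ?mul1r//; exact: V'c.
(* agrees with [F] on [V'], but is built from global functions *)
pose F' : 'C^oo(M) := constf (F (param c u)) + \sum_i (f i - constf (u 0 i)) * H i.
have -> : v F = v F'.
  apply: (@tangent_local _ v (param c @` V')); [exact: open_param|by exists u|].
  move=> _ [w V'w <-]; rewrite smoothfD smoothf_sum.
  have := GE w; rewrite /G !fctE !phi1// !mul1r => ->.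
  congr (_ + _); apply: eq_bigr => i _.
  rewrite smoothfM smoothfD smoothfN HE// fE//; exact: V'V.
rewrite tangentD tangent_cst add0r tangent_sum; apply: eq_bigr => i _.
rewrite tangentM tangentB tangent_cst subr0 smoothfD smoothfN fE// subrr mul0r add0r.
rewrite HE// hu; congr (_ * _); apply: near_eq_derive.
have : nbhs u V' by exact: open_nbhs_nbhs.
by apply: filterS => w V'w; rewrite /G !fctE phi1// mul1r.
Qed.

(** The difference [W] between [X] and its expansion in the frame vanishes on [V],
    so [psi *: W = 0] for a bump [psi] at the point supported in [V]; linearity over
    functions then gives [T W = 0] at the point. *)
Lemma tensor_coordinates c V f E u (T : vfield M -> 'C^oo(M)) (X : vfield M) :
  coordinates c V f -> coordinate_frame c V E -> V u ->
  (forall (g : 'C^oo(M)) Y Z, T (g *: Y + Z) = g * T Y + T Z) ->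
  T X (param c u) = \sum_i X (f i) (param c u) * T (E i) (param c u).
Proof.
move=> cf cE Vu Tlin; have [oV Vc fE] := cf.
have T0 : T 0 = 0.
  have := Tlin 1 0 0; rewrite scaler0 addr0 mul1r => /(canLR (addrK _)).
  by rewrite subrr.
have TZ g Y : T (g *: Y) = g * T Y by rewrite -[g *: Y]addr0 Tlin T0 addr0.
have TD Y Z : T (Y + Z) = T Y + T Z by rewrite -[Y]scale1r Tlin mul1r scale1r.
pose S : vfield M := \sum_i (X (f i) : 'C^oo(M)) *: E i.
pose W := X - S.
have oA := open_param oV Vc.
have Ap : (param c @` V) (param c u) by exists u.
have [psi [psi1 psi0]] := bump_at oA Ap.
have psiW : psi *: W = 0.
  apply: vfield_eq => g; apply: smoothfE => p.
  rewrite -[LHS]/(psi p * (X g p - S g p)) -[RHS]/(0 : R).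
  have [[w Vw <-]|/psi0 ->] := pselect ((param c @` V) p); last by rewrite mul0r.
  have := tangent_coordinates (vfield_at X (param c w)) g cf Vw => /= ->.
  rewrite /S vfield_sum smoothf_sum -sumrB big1 ?mulr0// => i _.
  rewrite -[(_ *: E i) g]/((X (f i) : 'C^oo(M)) * E i g) smoothfM cE//.
  by rewrite mulrC subrr.
have TW : T W (param c u) = 0.
  have : (psi * T W) (param c u) = 0 by rewrite -TZ psiW T0.
  by rewrite smoothfM psi1 mul1r.
have -> : X = W + S by rewrite /W subrK.
rewrite TD smoothfD TW add0r.
have -> : T S = \sum_i X (f i) * T (E i).
  rewrite /S; elim/big_rec2 : _ => // i Y Z _ <-.
  by rewrite TD TZ.
by rewrite smoothf_sum subrK.
Qed.

End ManifoldTopology.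
(** * The cotangent bundle as a manifold *)

Section Covectors.
Context {R : realType} {n : nat} {M : atlas R n}.

Lemma covector_lin p (xi : covector M p) (a : R) v w : xi (a *: v + w) = a * xi v + xi w.
Proof. by case: xi => xi /= /asboolP; apply. Qed.

Lemma covector0 p (xi : covector M p) : xi 0 = 0.
Proof.
have := covector_lin xi 1 0 0; rewrite scaler0 addr0 mul1r => /(canLR (addrK _)).
by rewrite subrr.
Qed.

Lemma covector_comb p (xi : covector M p) k (a : 'I_k -> R) (v : 'I_k -> tangent M p) :
  xi (\sum_i a i *: v i) = \sum_i a i * xi (v i).
Proof.
elim/big_rec2 : _ => [|i y x _ <-]; first exact: covector0.
by rewrite covector_lin.
Qed.

Lemma tangent_comb p k (a : 'I_k -> R) (v : 'I_k -> tangent M p) (F : 'C^oo(M)) :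
  (\sum_i a i *: v i) F = \sum_i a i * v i F.
Proof. by elim/big_rec2 : _ => // i y x _ <-. Qed.

(** The function on the cotangent bundle that is linear on the fibres and given
    by [Z]; these functions, with those pulled back from [M], provide coordinates. *)
Definition fibre_eval (Z : vfield M) (xi : cotangent M) : R :=
  projT2 xi (vfield_at Z (projT1 xi)).

Hypothesis hM : is_manifold M.
Section InCoordinates.
Variables (c : chart M) (V : set 'rV[R]_n) (f : 'I_n -> 'C^oo(M)) (E : 'I_n -> vfield M).
Hypotheses (cf : coordinates c V f) (cE : coordinate_frame c V E).

Lemma tangent_span u (v : tangent M (param c u)) : V u ->
  v = \sum_i v (f i) *: vfield_at (E i) (param c u).
Proof.
move=> Vu; apply: tangent_eq => F.
rewrite tangent_comb (tangent_coordinates hM v F cf Vu); apply: eq_bigr => i _.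
by rewrite /= cE// mulrC.
Qed.

Lemma frame_coordinates u i j : V u -> E i (f j) (param c u) = (i == j)%:R.
Proof.
move=> Vu; rewrite cE// -(derive_coord i j u); apply: near_eq_derive.
have [oV _ fE] := cf; have : nbhs u V by exact: open_nbhs_nbhs.
by apply: filterS => w Vw /=; exact: fE.
Qed.

Lemma coord_vectorE u (cu : dom c u) i : V u ->
  coord_vector cu i = vfield_at (E i) (param c u).
Proof. by move=> Vu; apply: tangent_eq => F /=; rewrite cE. Qed.

Fact pseudo_coord_covector_subproof u (y : 'rV[R]_n) :
  (fun v : tangent M (param c u) => \sum_i y 0 i * v (f i) : R^o) \in
    @linear_functional _ _ M (param c u).
Proof.
apply/asboolP => a v w; rewrite mulr_sumr -big_split; apply: eq_bigr => i _.
by rewrite -[LHS]/(y 0 i * (a * v (f i) + w (f i))) /=; ring.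
Qed.

Lemma coord_covectorE u (y : 'rV[R]_n) i : V u ->
  coord_covector c u y (vfield_at (E i) (param c u)) = y 0 i.
Proof.
move=> Vu; have cu : dom c u by case: cf => _ + _; exact.
rewrite -(coord_vectorE cu)// /coord_covector.
set P := [set _ | _].
have : P (xget 0 P).
  apply: xgetPex; exists (Covector (pseudo_coord_covector_subproof u y)) => cu' j.
  rewrite coord_vectorE//= (bigD1 j)//= big1 ?addr0 => [|k kj].
    by rewrite frame_coordinates// eqxx mulr1.
  by rewrite frame_coordinates// eq_sym (negbTE kj) mulr0.
by apply.
Qed.

Lemma fibre_eval_param (Z : vfield M) (z : 'rV[R]_(n + n)) : V (lsubmx z) ->
  fibre_eval Z (param (c : chart (cotangent M)) z) =
    \sum_j Z (f j) (param c (lsubmx z)) * rsubmx z 0 j.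
Proof.
move=> Vz; rewrite /fibre_eval /= (tangent_span (vfield_at Z _) Vz) covector_comb.
by apply: eq_bigr => i _; rewrite coord_covectorE.
Qed.

Lemma fibre_eval_frame j (z : 'rV[R]_(n + n)) : V (lsubmx z) ->
  fibre_eval (E j) (param (c : chart (cotangent M)) z) = rsubmx z 0 j.
Proof. by move=> Vz; rewrite /fibre_eval /= coord_covectorE. Qed.

End InCoordinates.

Lemma tangent_vfield p (v : tangent M p) : exists Z, vfield_at Z p = v.
Proof.
have [c [u cu up]] := chart_cover hM p; case: _ / up v => v.
have [V [f [E [Vu cf cE]]]] := local_coordinates hM cu.
exists (\sum_i constf (v (f i)) *: E i); apply: tangent_eq => F.
rewrite [in RHS](tangent_span cf cE v Vu) tangent_comb.
by rewrite -[LHS]/((\sum_i constf (v (f i)) *: E i) F (param c u)) vfield_sum smoothf_sum.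
Qed.

(** Comparing values of [fibre_eval] avoids transporting covectors along an
    equality of base points. *)
Lemma cotangent_eq (xi eta : cotangent M) : projT1 xi = projT1 eta ->
  (forall Z, fibre_eval Z xi = fibre_eval Z eta) -> xi = eta.
Proof.
case: xi eta => [p xi] [q eta] /= pq; case: _ / pq eta => eta H.
congr existT; apply/val_inj/funext => v; have [Z <-] := tangent_vfield v.
exact: H.
Qed.

(** The fibre coordinates of a covector are its values on a coordinate frame. *)
Lemma cotangent_param_onto c (xi : cotangent M) : chart_dom c (projT1 xi) ->
  exists z, dom c (lsubmx z) /\ param (c : chart (cotangent M)) z = xi.
Proof.
case: xi => [p xi] /= [u cu up]; case: _ / up xi => xi.
have [V [f [E [Vu cf cE]]]] := local_coordinates hM cu.
pose z := row_mx u (\row_i xi (vfield_at (E i) (param c u))).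
have zl : lsubmx z = u by rewrite row_mxKl.
exists z; split; first by rewrite zl.
apply: cotangent_eq => [|Z]; first by rewrite /= zl.
rewrite (fibre_eval_param cf cE) zl// /fibre_eval [projT1 _]/= [projT2 _]/=.
rewrite [in RHS](tangent_span cf cE (vfield_at Z _) Vu) covector_comb.
by apply: eq_bigr => i _; rewrite row_mxKr mxE.
Qed.

End Covectors.

Section SubmxSmooth.
Context {R : realType} {n : nat}.

Lemma open_lsubmx (W : set 'rV[R]_n) : open W ->
  open [set z : 'rV[R]_(n + n) | W (lsubmx z)].
Proof.
have cl : continuous (lsubmx : 'rV[R]_(n + n) -> 'rV[R]_n) by exact: continuous_lsubmx.
by move/continuousP: cl; apply.
Qed.

Lemma smooth_lsubmx (W : set 'rV[R]_(n + n)) : open W ->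
  smooth_on_rV W (lsubmx : 'rV[R]_(n + n) -> 'rV[R]_n).
Proof.
move=> oW j; apply: (smooth_eq oW (f := fun z => z 0 (lshift n j))).
  by move=> x _; rewrite mxE.
exact: smooth_coord.
Qed.

Lemma smooth_rsubmx (W : set 'rV[R]_(n + n)) : open W ->
  smooth_on_rV W (rsubmx : 'rV[R]_(n + n) -> 'rV[R]_n).
Proof.
move=> oW j; apply: (smooth_eq oW (f := fun z => z 0 (rshift n j))).
  by move=> x _; rewrite mxE.
exact: smooth_coord.
Qed.

Lemma smooth_comp_lsubmx (W : set 'rV[R]_n) (g : 'rV[R]_n -> R) : open W ->
    smooth_on W g ->
  smooth_on [set z : 'rV[R]_(n + n) | W (lsubmx z)] (fun z => g (lsubmx z)).
Proof.
move=> oW sg; have oT := open_lsubmx oW.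
by apply: (smooth_comp oT (smooth_lsubmx oT) _ sg) => z.
Qed.

End SubmxSmooth.

Section CotangentManifold.
Context {R : realType} {n : nat} {M : atlas R n}.
Hypothesis hM : is_manifold M.
Implicit Types (c d : chart M).

Lemma fibre_eval_smooth (Z : vfield M) : fibre_eval Z \in @smooth_fun _ _ (cotangent M).
Proof.
apply/asboolP => c; apply: smooth_local => z cz.
have [V [f [E [Vu cf cE]]]] := local_coordinates hM cz.
have [oV Vc _] := cf.
have oW := open_lsubmx oV.
exists [set z | V (lsubmx z)]; split=> //.
pose g : 'rV[R]_(n + n) -> R :=
    \sum_j (fun z => (Z (f j) \o param (c : chart M)) (lsubmx z)) * (fun z =>
        rsubmx z 0 j).
apply: (smooth_eq oW (f := g)).
  move=> w Vw; rewrite /= (fibre_eval_param hM cf cE)// /g fct_sumE.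
  by apply: eq_bigr.
apply: smooth_sum => // j; apply: smoothM => //; last exact: smooth_rsubmx.
exact/smooth_comp_lsubmx/(smooth_sub Vc)/smooth_param.
Qed.

Definition fibre_lin Z : 'C^oo(cotangent M) := SmoothF (fibre_eval_smooth Z).

Lemma cotangent_overlap (c d : chart M) :
  @overlap _ _ (cotangent M) c d = [set z | overlap c d (lsubmx z)].
Proof.
apply/seteqP; split => z /= [cz].
  by move=> [w dw /(congr1 (@projT1 _ _)) /= e]; split=> //; exists (lsubmx w).
move=> H; split=> //.
have [w [dw wz]] := cotangent_param_onto hM (xi := param (c : chart (cotangent M)) z) H.
by exists w.
Qed.

Lemma cotangent_overlap_open (c d : chart (cotangent M)) : open (overlap c d).
Proof. by rewrite cotangent_overlap; apply: open_lsubmx; exact: (overlap_open hM). Qed.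

Lemma cotangent_param_inj (c : chart (cotangent M)) : {in dom c &, injective (param c)}.
Proof.
move=> z w; rewrite !inE => cz cw zw.
have lzw : lsubmx z = lsubmx w.
  by apply: (param_inj hM cz cw); exact: (congr1 (@projT1 _ _) zw).
have [V [f [E [Vz cf cE]]]] := local_coordinates hM cz.
have Vw := Vz; rewrite lzw in Vw.
rewrite -[z]hsubmxK -[w]hsubmxK lzw; congr row_mx; apply/rowP => j.
by rewrite -(fibre_eval_frame cf cE)// -[RHS](fibre_eval_frame cf cE)// zw.
Qed.

(** The new fibre coordinates are the values on the new coordinate fields, which
    the Jacobian matrix of the inverse transition [k'] expresses in the old ones. *)
Lemma cotangent_transition (c d : chart (cotangent M)) :
  exists h : 'rV[R]_(n + n) -> 'rV[R]_(n + n), smooth_on_rV (overlap c d) h /\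
    forall u, overlap c d u -> dom d (h u) /\ param d (h u) = param c u.
Proof.
have [k [sk kE]] := transition_smooth hM c d.
have [k' [sk' k'E]] := transition_smooth hM d c.
pose y (z : 'rV[R]_(n + n)) : 'rV[R]_n := \row_j \sum_i
  rsubmx z 0 i * 'D_(delta_mx 0 j) (fun w => k' w 0 i) (k (lsubmx z)).
exists (fun z => row_mx (k (lsubmx z)) (y z)).
have oov (a b : chart M) : open (overlap a b) by exact: (overlap_open hM).
have kov u : @overlap _ _ M c d u -> @overlap _ _ M d c (k u).
  move=> ov; have [dk ke] := kE _ ov; split=> //.
  by exists u; [case: ov|].
rewrite cotangent_overlap; split.
  have oT := open_lsubmx (oov c d).
  have skl : smooth_on_rV [set z : 'rV[R]_(n + n) | @overlap _ _ M c d (lsubmx z)]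
      (fun z => k (lsubmx z)).
    by move=> j; exact: (smooth_comp_lsubmx (oov c d) (sk j)).
  move=> j; have [i ->|i ->] := split_ordP j.
    by apply: (smooth_eq oT _ (skl i)) => z _; rewrite row_mxEl.
  pose g : 'rV[R]_(n + n) -> R := \sum_l (fun z => rsubmx z 0 l) *
     ('D_(delta_mx 0 i) (fun w => k' w 0 l) \o (fun z => k (lsubmx z))).
  apply: (smooth_eq oT (f := g)) => [z _|].
    by rewrite row_mxEr mxE /g fct_sumE.
  apply: smooth_sum => // l; apply: smoothM => //; first exact: smooth_rsubmx.
  by apply: (smooth_comp oT skl _ (smooth_derive i (sk' l))) => z; exact: kov.
move=> z ov; have [dk ke] := kE _ ov.
have zl : lsubmx (row_mx (k (lsubmx z)) (y z)) = k (lsubmx z) by rewrite row_mxKl.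
split; first by rewrite /= zl.
apply: (cotangent_eq hM) => [|Z]; first by rewrite /= zl ke.
have [V [f [E [Vu cf cE]]]] := local_coordinates hM ov.1.
have [V' [f' [E' [V'u cf' cE']]]] := local_coordinates hM dk.
rewrite (fibre_eval_param hM cf' cE') ?zl// (fibre_eval_param hM cf cE)// row_mxKr -ke.
have Zf i : Z (f i) (param (d : chart M) (k (lsubmx z))) =
    \sum_j 'D_(delta_mx 0 j) (fun w => k' w 0 i) (k (lsubmx z)) *
      Z (f' j) (param (d : chart M) (k (lsubmx z))).
  rewrite -[LHS]/(vfield_at Z _ (f i)) (tangent_coordinates hM _ (f i) cf' V'u).
  apply: eq_bigr => j _; congr (_ * _); apply: near_eq_derive.
  have [oV Vc fE] := cf.
  have : nbhs (k (lsubmx z)) (overlap (d : chart M) (c : chart M) `&` k' @^-1` V).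
    apply: open_nbhs_nbhs; split; first exact: open_preimage.
    split; first exact: kov.
    have [ck' k'e] := k'E _ (kov _ ov).
    rewrite /preimage /= (_ : k' _ = lsubmx z)//.
    by apply: (param_inj hM ck' ov.1); rewrite k'e ke.
  apply: filterS => w [ovw Vw]; have [ck' k'e] := k'E _ ovw.
  by rewrite /= -k'e fE.
under eq_bigr do rewrite mxE mulr_sumr.
rewrite exchange_big /=; apply: eq_bigr => i _.
by rewrite Zf mulr_suml; apply: eq_bigr => j _; ring.
Qed.

Lemma smoothf_open (m : nat) (N : atlas R m) (F : 'C^oo(N)) (U : set R) :
  open U -> atlas_open (F @^-1` U).
Proof.
move=> oU c; rewrite openE => z [cz Uz]; apply: filterI.
  by apply: open_nbhs_nbhs; split=> //; exact: dom_open.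
apply: (smooth_continuous (smooth_param c F) cz); exact: open_nbhs_nbhs.
Qed.

(** Covectors over one point are separated by a function [fibre_lin Z], covectors
    over different points by neighbourhoods of these points. *)
Lemma cotangent_hausdorff (xi eta : cotangent M) : xi <> eta ->
  exists A B : set (cotangent M),
    [/\ atlas_open A, atlas_open B, A xi, B eta & A `&` B = set0].
Proof.
move=> xe; have [pq|pq] := pselect (projT1 xi = projT1 eta).
  have [Z Zxe] : exists Z, fibre_eval Z xi <> fibre_eval Z eta.
    by apply/existsNP => H; apply: xe; exact: cotangent_eq.
  have hR := @norm_hausdorff R R.
  move: hR; rewrite open_hausdorff => /(_ (fibre_eval Z xi) (fibre_eval Z eta)).
  have /eqP ne := Zxe.
  move=> /(_ ne) [[A B] /= [xA eB] [oA oB /eqP AB]].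
  exists (fibre_lin Z @^-1` A), (fibre_lin Z @^-1` B).
  split; [exact: smoothf_open|exact: smoothf_open|exact/set_mem|exact/set_mem|].
  by rewrite -preimage_setI AB preimage_set0.
have [A [B [oA oB Ax Be AB]]] := manifold_hausdorff hM pq.
have H (C : set M) : atlas_open C ->
    @atlas_open _ _ (cotangent M) ((@projT1 _ _) @^-1` C).
  by move=> oC c; exact: (open_lsubmx (oC c)).
exists ((@projT1 _ _) @^-1` A), ((@projT1 _ _) @^-1` B); split=> //; [exact: H|exact: H|].
by rewrite -preimage_setI AB preimage_set0.
Qed.

End CotangentManifold.
Section SecondCountable.
Context {R : realType}.

Lemma rational_ball n (W : set 'rV[R]_n) z : open W -> W z ->
  exists (q : 'rV[rat]_n) (l : nat),
    let B := ball (map_mx ratr q : 'rV[R]_n) l.+1%:R^-1 in B z /\ B `<=` W.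
Proof.
move=> oW Wz; have /nbhs_ballP[e /= e0 eW] : nbhs z W by exact: open_nbhs_nbhs.
have [l] : exists l, (l.+1%:R^-1 : R) < e / 2.
  have := near_infty_natSinv_lt (PosNum (divr_gt0 e0 (ltr0Sn R 1))).
  by case=> l _ /(_ l (leqnn l)) /=; exists l.
set r := _^-1 => le.
have r0 : 0 < r by rewrite invr_gt0.
have H (i : 'I_n) : exists q : rat, `|ratr q - z 0 i| < r.
  have := @rat_in_itvoo R (z 0 i - r) (z 0 i + r).
  have lt : z 0 i - r < z 0 i + r by lra.
  move=> /(_ lt)[q]; rewrite in_itv /= => /andP[q1 q2]; exists q.
  by rewrite ltr_norml; lra.
have [q Hq] := choice H.
exists (\row_i q i), l => /=; split.
  by split=> // i j; rewrite ord1 !mxE /ball /=; exact: Hq.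
move=> w [_ qw]; apply: eW; split=> // i j; rewrite ord1 /ball /=.
have := qw 0 j; rewrite !mxE /ball /= => qwj; have := Hq j.
rewrite -/r in qwj le *; move: qwj; rewrite !ltr_norml; lra.
Qed.

(** The images of balls with rational centre and radius [1 / (l + 1)] in
    countably many charts form a base. *)
Lemma second_countable_charts n (N : atlas R n) (C : nat -> option (chart N)) :
  (forall c W, open W -> W `<=` dom c -> atlas_open (param (a := N) c @` W)) ->
  (forall p : N, exists k c, C k = Some c /\ chart_dom c p) ->
  exists B : nat -> set N, (forall k, atlas_open (B k)) /\
    (forall A p, atlas_open A -> A p -> exists k, B k p /\ B k `<=` A).
Proof.
move=> oP cover.
pose U (c : chart N) (q : 'rV[rat]_n) (l : nat) :=
  dom c `&` ball (map_mx ratr q : 'rV[R]_n) l.+1%:R^-1.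
have oU c q l : open (U c q l).
  by apply: openI; [exact: dom_open|exact: ball_open].
pose B (k : nat) : set N :=
  if (unpickle k : option (nat * 'rV[rat]_n * nat)) is Some (k', q, l) then
    if C k' is Some c then param c @` U c q l else set0
  else set0.
have o0 : @atlas_open _ _ N set0.
  by move=> c; rewrite preimage_set0 setI0; exact: open0.
exists B; split=> [k|A p oA Ap].
  rewrite /B; case: unpickle => [[[k' q] l]|//]; case: (C k') => [c|//].
  by apply: oP => // u [].
have [k [c [Ck [u cu up]]]] := cover p.
have [|q [l [Bu BW]]] := rational_ball (oA c) (z := u).
  by split=> //=; rewrite up.
exists (pickle (k, q, l)); rewrite /B pickleK Ck; split; first by exists u.
by move=> _ [w [cw Bw] <-]; have [] := BW _ Bw.
Qed.

End SecondCountable.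

Section CotangentSecondCountable.
Context {R : realType} {n : nat} {M : atlas R n}.
Hypothesis hM : is_manifold M.

(** Lindelof's argument: for each basic open set contained in some chart domain,
    keep one such chart. *)
Lemma countable_charts : exists C : nat -> option (chart M),
  forall p : M, exists k c, C k = Some c /\ chart_dom c p.
Proof.
have [B [oB HB]] := manifold_second_countable hM.
exists (fun k => if pselect (exists c : chart M, B k `<=` chart_dom c) is left H
                 then Some (projT1 (cid H)) else None) => p.
have [c cp] := chart_cover hM p.
have [k [Bp Bc]] := HB _ _ (chart_dom_open hM (c := c)) cp.
exists k; case: pselect => [H|[]]; last by exists c.
by exists (projT1 (cid H)); split=> //; case: cid => /= d; apply.
Qed.

Lemma cotangent_manifold : is_manifold (cotangent M).
Proof.
split.
- exact: cotangent_param_inj.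
- move=> xi; have [c cp] := chart_cover hM (projT1 xi).
  have [z [cz zxi]] := cotangent_param_onto hM cp.
  by exists c, z.
- exact: cotangent_overlap_open.
- exact: cotangent_transition.
- exact: cotangent_hausdorff.
- have [C HC] := countable_charts.
  apply: (@second_countable_charts R (n + n) (cotangent M) C).
    move=> c W; apply: open_param_overlap; first exact: cotangent_param_inj.
      by move=> d; exact: cotangent_overlap_open.
    by move=> d; exact: cotangent_transition.
  move=> xi; have [k [c [Ck cp]]] := HC (projT1 xi).
  have [z [cz zxi]] := cotangent_param_onto hM cp.
  by exists k, c; split=> //; exists z.
Qed.

End CotangentSecondCountable.

(** * Tangent vectors of the cotangent bundle *)

Section CotangentTangent.
Context {R : realType} {n : nat} {M : atlas R n}.
Hypothesis hM : is_manifold M.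
Let hT : is_manifold (cotangent M) := cotangent_manifold hM.

Definition base_fun (f : 'C^oo(M)) : 'C^oo(cotangent M) := pullback (cotangent_proj M) f.

Section Coordinates.
Variables (c : chart M) (V : set 'rV[R]_n) (f : 'I_n -> 'C^oo(M)) (E : 'I_n -> vfield M).
Hypotheses (cf : coordinates c V f) (cE : coordinate_frame c V E).

(** The splitting of ['I_(n + n)] is the one of [row_mx] in the charts of
    the cotangent bundle: base coordinates first, fibre coordinates last. *)
Definition cotangent_coordinate (k : 'I_(n + n)) : 'C^oo(cotangent M) :=
  match fintype.split k with inl i => base_fun (f i) | inr j => fibre_lin hM (E j) end.

Lemma cotangent_coordinates :
  @coordinates R _ (cotangent M) c [set z | V (lsubmx z)] cotangent_coordinate.
Proof.
have [oV Vc fE] := cf; split=> [|z /Vc//|z k Vz]; first exact: open_lsubmx.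
rewrite /cotangent_coordinate; case: split_ordP => [i ->|j ->].
  by rewrite /= fE// mxE.
by rewrite -[LHS]/(fibre_eval (E j) (param (c : chart (cotangent M)) z))
    (fibre_eval_frame cf cE)// mxE.
Qed.

Lemma tangent_cotangent_coordinates z
    (w : tangent (cotangent M) (param (c : chart (cotangent M)) z)) F :
  V (lsubmx z) ->
  w F = \sum_i 'D_(delta_mx 0 (lshift n i)) (F \o param (c : chart (cotangent M))) z *
          w (base_fun (f i)) +
        \sum_j 'D_(delta_mx 0 (rshift n j)) (F \o param (c : chart (cotangent M))) z *
          w (fibre_lin hM (E j)).
Proof.
move=> Vz; rewrite (tangent_coordinates hT w F cotangent_coordinates Vz) big_split_ord /=.
congr (_ + _); apply: eq_bigr => i _; rewrite /cotangent_coordinate.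
  by rewrite (unsplitK (inl i : 'I_n + 'I_n)).
by rewrite (unsplitK (inr i : 'I_n + 'I_n)).
Qed.

End Coordinates.

Lemma cotangent_chart (xi : cotangent M) : exists (c : chart M) z V f E,
  [/\ param (c : chart (cotangent M)) z = xi, V (lsubmx z), coordinates c V f &
      coordinate_frame c V E].
Proof.
have [c [z cz zxi]] := chart_cover hT xi.
have [V [f [E [Vz cf cE]]]] := local_coordinates hM (cz : dom (c : chart M) (lsubmx z)).
by exists c, z, V, f, E.
Qed.

(** Functions pulled back from [M] and functions linear on the fibres contain
    coordinates around every point.  All identities between vector fields on the
    cotangent bundle are checked on them. *)
Lemma cotangent_tangent_eq (xi : cotangent M) (v w : tangent (cotangent M) xi) :
  (forall f, v (base_fun f) = w (base_fun f)) ->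
  (forall Z, v (fibre_lin hM Z) = w (fibre_lin hM Z)) -> v = w.
Proof.
have [c [z [V [f [E [zxi Vz cf cE]]]]]] := cotangent_chart xi.
case: _ / zxi v w => v w vb vl; apply: tangent_eq => F.
rewrite !(tangent_cotangent_coordinates cf cE _ _ Vz).
by congr (_ + _); apply: eq_bigr => i _; rewrite ?vb ?vl.
Qed.

Lemma cotangent_vfield_eq (P Q : vfield (cotangent M)) :
  (forall f, P (base_fun f) = Q (base_fun f)) ->
  (forall Z, P (fibre_lin hM Z) = Q (fibre_lin hM Z)) -> P = Q.
Proof.
move=> Pb Pl; apply: vfield_eq => F; apply: smoothfE => xi.
have /(congr1 (fun v : tangent _ _ => v F)) : vfield_at P xi = vfield_at Q xi.
  by apply: cotangent_tangent_eq => [f|Z] /=; rewrite ?Pb ?Pl.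
by [].
Qed.

Lemma fibre_lin_tens (g : 'C^oo(M)) (Y Z : vfield M) xi :
  fibre_lin hM (g *: Y + Z) xi = g (projT1 xi) * fibre_lin hM Y xi + fibre_lin hM Z xi.
Proof.
rewrite -[LHS]/(projT2 xi (vfield_at (g *: Y + Z) (projT1 xi))).
have -> : vfield_at (g *: Y + Z) (projT1 xi) =
  g (projT1 xi) *: vfield_at Y (projT1 xi) + vfield_at Z (projT1 xi).
  by apply: tangent_eq.
by rewrite covector_lin.
Qed.

Lemma fibre_linB (Y Z : vfield M) : fibre_lin hM (Y - Z) =
    fibre_lin hM Y - fibre_lin hM Z.
Proof.
have -> : Y - Z = -1 *: Z + Y by rewrite scaleN1r addrC.
apply: smoothfE => xi; rewrite fibre_lin_tens.
by rewrite -[(-1 : 'C^oo(M)) _]/(- 1 : R) mulN1r smoothfD smoothfN addrC.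
Qed.

End CotangentTangent.
(** * Sections parallel at a point *)

Section SectionsOfCotangent.
Context {R : realType} {n : nat} {M : atlas R n}.
Hypothesis hM : is_manifold M.

Lemma tensor_at p (T : vfield M -> 'C^oo(M)) (X Y : vfield M) :
  (forall (g : 'C^oo(M)) Y Z, T (g *: Y + Z) = g * T Y + T Z) ->
  vfield_at X p = vfield_at Y p -> T X p = T Y p.
Proof.
move=> Tlin XY; have [c [u cu up]] := chart_cover hM p; case: _ / up XY => XY.
have [V [f [E [Vu cf cE]]]] := local_coordinates hM cu.
rewrite !(tensor_coordinates hM _ cf cE Vu Tlin); apply: eq_bigr => i _.
by congr (_ * _); exact: (congr1 (fun v : tangent _ _ => v (f i)) XY).
Qed.

Section Combination.
Variables (g f : 'I_n -> 'C^oo(M)).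

Fact comb_form_subproof :
  (fun Z : vfield M => \sum_j g j * Z (f j) : 'C^oo(M)^o) \in @tensorial _ _ M.
Proof.
apply/asboolP => h Y Z; rewrite mulr_sumr -big_split; apply: eq_bigr => j _.
by rewrite -[LHS]/(g j * (h * Y (f j) + Z (f j))) /=; ring.
Qed.
(** The form [sum_j g_j df_j]; unlike an arbitrary form, it has an evident value
    on a tangent vector, hence an evident section of the cotangent bundle. *)
Definition comb_form : form1 M := Form1 comb_form_subproof.

Fact comb_covector_subproof p :
  (fun v : tangent M p => \sum_j g j p * v (f j) : R^o) \in @linear_functional _ _ M p.
Proof.
apply/asboolP => a v w; rewrite mulr_sumr -big_split; apply: eq_bigr => j _.
by rewrite -[LHS]/(g j p * (a * v (f j) + w (f j))) /=; ring.
Qed.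
Definition comb_covector p : covector M p := Covector (comb_covector_subproof p).

Fact comb_section_subproof (c : chart M) u : dom c u ->
  exists (d : chart (cotangent M)) (h : 'rV[R]_n -> 'rV[R]_(n + n)) (W : set 'rV[R]_n),
    [/\ open W, W u, W `<=` dom c, smooth_on_rV W h &
        forall w, W w -> dom d (h w) /\
          param d (h w) = existT _ (param c w) (comb_covector (param c w))].
Proof.
move=> cu; have oc := @dom_open _ _ M c.
pose y w : 'rV[R]_n := \row_i \sum_j g j (param c w) * 'D_(delta_mx 0 i)
    (f j \o param c) w.
exists c, (fun w => row_mx w (y w)), (dom c); split=> //.
  move=> k; have [i ->|i ->] := split_ordP k.
    by apply: (smooth_eq oc _ (smooth_coord i oc)) => w _; rewrite row_mxEl.
  apply: (smooth_eq oc (f :=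
      \sum_j (g j \o param c) * 'D_(delta_mx 0 i) (f j \o param c))).
    by move=> w _; rewrite row_mxEr mxE fct_sumE.
  apply: smooth_sum => // j; apply: smoothM => //; first exact: smooth_param.
  exact/smooth_derive/smooth_param.
move=> w cw; split; first by rewrite /= row_mxKl.
apply: (cotangent_eq hM) => [|Z]; first by rewrite /= row_mxKl.
have [V [f' [E [Vw cf cE]]]] := local_coordinates hM cw.
rewrite (fibre_eval_param hM cf cE) row_mxKl// row_mxKr.
rewrite -[RHS]/(\sum_j g j (param c w) * vfield_at Z (param c w) (f j)).
under [RHS]eq_bigr do rewrite (tangent_coordinates hM _ _ cf Vw) mulr_sumr.
rewrite exchange_big; apply: eq_bigr => i _ /=.
rewrite mxE mulr_sumr; apply: eq_bigr => j _.
by rewrite mulrCA [in RHS]mulrC [in RHS]mulrC mulrA [RHS]mulrC; ring.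
Qed.
Definition comb_section : smooth_map M (cotangent M) := 
  @SmoothMap R n (n + n) M (cotangent M)
    (fun x => existT (covector M) x (comb_covector x)) comb_section_subproof.

Lemma comb_is_section : is_section_of comb_form comb_section.
Proof. by move=> x; split=> // Z; rewrite /= smoothf_sum. Qed.

End Combination.

Variable D : affine_connection M.

Lemma dual_connection_tens (g : 'C^oo(M)) X Y (a : form1 M) Z :
  dual_connection D (g *: X + Y) a Z =
  g * dual_connection D X a Z + dual_connection D Y a Z.
Proof.
rewrite -[LHS]/((g * X (a Z) + Y (a Z)) - a (D (g *: X + Y) Z)).
by rewrite nabla_tens form1D form1Z /=; ring.
Qed.

(** Write the form as [a = sum_j g_j df_j].  It passes through [xi] when
    [g_j = xi E_j] at the point, and by tensoriality in [V] and [Z] it is parallel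
    there when [E_i (a E_j) = a (D E_i E_j)], that is when the [i]-th partial
    derivative of [g_j] is [xi (D E_i E_j)].  An affine function of the coordinates
    has this value and these derivatives. *)
Lemma parallel_section (xi : cotangent M) :
  exists (a : form1 M) (s : smooth_map M (cotangent M)),
    [/\ is_section_of a s, s (projT1 xi) = xi &
        forall V Z, dual_connection D V a Z (projT1 xi) = 0].
Proof.
have [c [z [V [f [E [zxi Vz cf cE]]]]]] := cotangent_chart hM xi.
have [oV Vc fE] := cf.
pose u := lsubmx z; pose p := param c u.
have xip : projT1 xi = p by rewrite -zxi.
(* the Christoffel symbols at the base point, contracted with [xi] *)
pose k i j := fibre_eval (D (E i) (E j)) xi.
pose g j : 'C^oo(M) := constf (fibre_eval (E j) xi) +
  \sum_i constf (k i j) * (f i - constf (u 0 i)).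
have gp j : g j p = fibre_eval (E j) xi.
  rewrite /g smoothfD smoothf_sum big1 ?addr0// => i _.
  by rewrite smoothfM smoothfD smoothfN /p fE// subrr mulr0.
have a_eval W : comb_form g f W p = fibre_eval W xi.
  rewrite /= smoothf_sum -zxi (fibre_eval_param hM cf cE)//; apply: eq_bigr => j _.
  by rewrite smoothfM gp -zxi (fibre_eval_frame cf cE)// mulrC.
exists (comb_form g f), (comb_section g f); split.
- exact: comb_is_section.
- apply: (cotangent_eq hM) => [//|Z].
  by rewrite -a_eval -xip; exact: (comb_is_section g f (projT1 xi)).2.
move=> X Z; rewrite xip.
rewrite (tensor_coordinates hM (T := fun X => dual_connection D X (comb_form g f) Z) X
    cf cE Vz); last first.
  by move=> h Y W; exact: dual_connection_tens.
apply: big1 => i _.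
rewrite (tensor_coordinates hM (T := dual_connection D (E i) (comb_form g f)) Z cf cE
    Vz); last first.
  by move=> h Y W; exact: form1_tens.
rewrite big1 ?mulr0// => j _.
rewrite [dual_connection _ _ _]lock /= -lock -/u -/p.
have -> : dual_connection D (E i) (comb_form g f) (E j) p =
   E i (comb_form g f (E j)) p - comb_form g f (D (E i) (E j)) p by [].
rewrite a_eval -/(k i j).
have -> : E i (comb_form g f (E j)) p = vfield_at (E i) p (g j).
  rewrite -[LHS]/(vfield_at (E i) p (comb_form g f (E j))).
  apply: (tangent_local hM _ (open_param hM oV Vc)); first by exists u.
  move=> _ [w Vw <-].
  rewrite -[LHS]/((\sum_l g l * E j (f l)) (param c w)) smoothf_sum (bigD1 j)//.
  rewrite -[RHS]addr0; congr (_ + _); last (apply: big1 => l lj);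
    rewrite smoothfM (frame_coordinates cf cE)// ?eqxx ?mulr1//.
  by rewrite eq_sym (negbTE lj) mulr0.
rewrite /g tangentD tangent_cst add0r tangent_sum.
have Ek l : vfield_at (E i) p (constf (k l j) * (f l - constf (u 0 l))) =
    k l j * (i == l)%:R.
  by rewrite tangentZ tangentB tangent_cst subr0 /= (frame_coordinates cf cE).
under eq_bigr do rewrite Ek.
rewrite (bigD1 i)//= big1 => [|l li]; first by rewrite eqxx mulr1 addr0 subrr mulr0.
by rewrite eq_sym (negbTE li) mulr0.
Qed.

End SectionsOfCotangent.
(** * Horizontal lifts *)

Section Lift.
Context {R : realType} {n : nat} {M : atlas R n}.
Hypothesis hM : is_manifold M.
Variable D : affine_connection M.

Lemma horizontal_lift_base_fun X P f : is_horizontal_lift D X P ->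
  P (base_fun f) = base_fun (X f).
Proof.
move=> HP; apply: smoothfE => xi; have [_ push] := HP xi.
exact: (congr1 (fun v : tangent _ _ => v f) push).
Qed.

(** Along a section [a] parallel in the direction [X] the function given by [Z]
    is [a Z], whose derivative is [a (D X Z)]. *)
Lemma horizontal_lift_fibre_lin X P Z : is_horizontal_lift D X P ->
  P (fibre_lin hM Z) = fibre_lin hM (D X Z).
Proof.
move=> HP; apply: smoothfE => xi; have [[a [s [V]]]] := HP xi.
set x := cotangent_proj M xi => /= -[sec sx par wF] _.
have aE W : pullback s (fibre_lin hM W) = a W.
  by apply: smoothfE => y; exact: (sec y).2.
have bE f : pullback s (base_fun f) = f.
  by apply: smoothfE => y; rewrite /= (sec y).1.
have VX : vfield_at V x = vfield_at X x.
  apply: tangent_eq => f; have := wF (base_fun f).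
  rewrite -[LHS]/(P (base_fun f) xi) (horizontal_lift_base_fun _ HP).
  by rewrite -[RHS]/(V (pullback s (base_fun f)) x) bE => /esym.
rewrite wF -[LHS]/(V (pullback s (fibre_lin hM Z)) x) aE.
have -> : V (a Z) x = a (D V Z) x by apply/subr0_eq; exact: par.
rewrite (tensor_at hM (T := fun Y => a (D Y Z)) _ VX) => [|g Y W].
  by rewrite -aE -[LHS]/(fibre_lin hM (D X Z) (s x)) sx.
by rewrite nabla_tens form1_tens.
Qed.

Lemma horizontal_lift_unique X P Q :
  is_horizontal_lift D X P -> is_horizontal_lift D X Q -> P = Q.
Proof.
move=> HP HQ; apply: (cotangent_vfield_eq (hM := hM)) => [f|Z].
  by rewrite (horizontal_lift_base_fun _ HP) (horizontal_lift_base_fun _ HQ).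
by rewrite (horizontal_lift_fibre_lin _ HP) (horizontal_lift_fibre_lin _ HQ).
Qed.

(** With [s_xi] a section through [xi] parallel at the base point, [X (F \o s_xi)]
    defines a tangent vector at [xi].  It sends [base_fun f] to [X f] and
    [fibre_lin Z] to [fibre_lin (D X Z)], which are smooth; as such functions include
    local coordinates, it depends smoothly on [xi]. *)
Lemma horizontal_lift_exists X : exists P, is_horizontal_lift D X P.
Proof.
have H (xi : cotangent M) : exists s : smooth_map M (cotangent M),
   exists a, [/\ is_section_of a s, s (projT1 xi) = xi &
        forall V Z, dual_connection D V a Z (projT1 xi) = 0].
  by have [a [s H]] := parallel_section hM D xi; exists s, a.
have {H} [s Hs] := choice H.
pose Pval F (xi : cotangent M) : R := X (pullback (s xi) F) (projT1 xi).
have Pbase f xi : Pval (base_fun f) xi = X f (projT1 xi).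
  rewrite /Pval; congr ((X _ : 'C^oo(M)) _).
  by have [a [sec _ _]] := Hs xi; apply: smoothfE => y; rewrite /= (sec y).1.
have Pell Z xi : Pval (fibre_lin hM Z) xi = fibre_lin hM (D X Z) xi.
  have [a [sec sx par]] := Hs xi.
  have aE W : pullback (s xi) (fibre_lin hM W) = a W.
    by apply: smoothfE => y; exact: (sec y).2.
  rewrite /Pval aE.
  have -> : X (a Z) (projT1 xi) = a (D X Z) (projT1 xi) by apply/subr0_eq; exact: par.
  by rewrite -aE -[LHS]/(fibre_lin hM (D X Z) (s xi (projT1 xi))) sx.
have Ptan xi : exists w : tangent (cotangent M) xi, forall F, w F = Pval F xi.
  have [a [sec sx par]] := Hs xi.
  have : exists w : tangent (cotangent M) (smooth_map_val (s xi) (projT1 xi)), forall F,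
      w F = Pval F xi.
    by exists (Defs.pushforward (s xi) (vfield_at X (projT1 xi))).
  by rewrite sx.
have Psmooth F : Pval F \in @smooth_fun _ _ (cotangent M).
  apply/asboolP => c; apply: smooth_local => z cz.
  have [V [f [E [Vz cf cE]]]] := local_coordinates hM (cz : dom (c : chart M) (lsubmx z)).
  have [oV Vc _] := cf; have oW := open_lsubmx oV.
  exists [set z | V (lsubmx z)]; split=> //.
  have sW (G : 'C^oo(cotangent M)) : smooth_on [set z | V (lsubmx z)] (G \o param c).
    by apply: smooth_sub (smooth_param c G) => w /Vc.
  apply: (smooth_eq oW (f :=
    (\sum_i 'D_(delta_mx 0 (lshift n i)) (F \o param c)
        * (base_fun (X (f i)) \o param c)) +
    (\sum_j 'D_(delta_mx 0 (rshift n j)) (F \o param c)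
        * (fibre_lin hM (D X (E j)) \o param c)))).
    move=> w Vw; rewrite /= -/(Pval F _).
    have [v vE] := Ptan (param c w); rewrite -vE.
    rewrite (tangent_cotangent_coordinates hM cf cE v F Vw).
    rewrite !fctE !fct_sumE; congr (_ + _); apply: eq_bigr => i _; rewrite vE.
      by rewrite Pbase.
    by rewrite Pell.
  by apply: smoothD => //; apply: smooth_sum => // i; apply: smoothM => //;
      exact: smooth_derive.
pose Pfun F : 'C^oo(cotangent M)^o := SmoothF (Psmooth F).
have Pder : Pfun \in @derivation _ _ (cotangent M).
  apply/asboolP; split=> [r F G|F G]; apply: smoothfE => xi; have [v vE] := Ptan xi.
    by rewrite smoothfD smoothfM /= -!vE tangentD tangentZ.
  by rewrite smoothfD !smoothfM /= -!vE tangentM.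
exists (VField Pder) => xi; split; last first.
  by apply: tangent_eq => f; exact: Pbase.
have [a [sec sx par]] := Hs xi; exists a, (s xi), X; split=> //.
Qed.

End Lift.
(** * The action *)

Theorem corollary4p23 (R : realType) (n : nat) (M : manifold R n)
    (H : form3 M) (H_closed : closed_form3 H)
    (nabla : affine_connection M) (nabla_flat : flat_connection nabla) :
  exists rho : exact_courant H -> vfield (cotangent M),
    (forall (X : vfield M) (alpha : form1 M),
       unique (is_horizontal_lift nabla X) (rho (X, alpha))) /\
    courant_action (cotangent_proj M) rho.
Proof.
have hM := manifoldP M.
have [lift liftP] := choice (horizontal_lift_exists hM nabla).
have lift_base_fun X f := horizontal_lift_base_fun f (liftP X).
have lift_fibre_lin X Z := horizontal_lift_fibre_lin hM Z (liftP X).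
exists (fun a => lift a.1); split=> [X alpha|].
  by split=> [|P HP]; [exact: liftP|exact: (horizontal_lift_unique hM (liftP X) HP)].
have lift_lin (g : 'C^oo(M)) X Y :
    lift (g *: X + Y) = pullback (cotangent_proj M) g *: lift X + lift Y.
  apply: (cotangent_vfield_eq (hM := hM)) => [f|Z]; apply: smoothfE => xi.
    rewrite lift_base_fun -[RHS]/(g (projT1 xi) * lift X (base_fun f) xi +
        lift Y (base_fun f) xi).
    by rewrite !lift_base_fun.
  rewrite lift_fibre_lin nabla_tens fibre_lin_tens.
  rewrite -[RHS]/(g (projT1 xi) * lift X (fibre_lin hM Z) xi +
      lift Y (fibre_lin hM Z) xi).
  by rewrite !lift_fibre_lin.
have lift0 : lift 0 = 0.
  have := lift_lin 1 0 0; rewrite scaler0 addr0.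
  have -> : pullback (cotangent_proj M) 1 = 1 by exact: smoothfE.
  by rewrite scale1r => /(canLR (addrK _)); rewrite subrr.
split.
- exact: cotangent_manifold.
- move=> c a b; rewrite -[LHS]/(lift (constf c *: a.1 + b.1)) lift_lin.
  by have -> : pullback (cotangent_proj M) (constf c) = constf c by exact: smoothfE.
- by move=> a q; have [] := liftP a.1 q.
- by move=> f a; rewrite -[LHS]/(lift (f *: a.1)) -[f *: a.1]addr0 lift_lin lift0 addr0.
- move=> a b; rewrite -[RHS]/(lift (lie a.1 b.1)).
  apply: (cotangent_vfield_eq (hM := hM)) => [f|Z].
    rewrite -[LHS]/(lift a.1 (lift b.1 (base_fun f)) - lift b.1 (lift a.1 (base_fun f))).
    by rewrite !lift_base_fun; exact: smoothfE.
  rewrite -[LHS]/(lift a.1 (lift b.1 (fibre_lin hM Z)) - lift b.1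
      (lift a.1 (fibre_lin hM Z))).
  have /subr0_eq flat := nabla_flat a.1 b.1 Z.
  by rewrite !lift_fibre_lin -flat fibre_linB.
Qed.
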